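(* Let $K$ be an arbitrary Borel subset of the complex plane. Let $\mu$ be an arbitrary (non-negative) finite measure on the Borel subsets $\mathfrak{B}(K)$ of $K$, having all finite power moments on $K$ (i.e. $\int_K |z|^j\,d\mu<\infty$ for all $j\in\mathbb{Z}_+$). Let $r\in\mathbb{N}$ and $G(z)=(d_0(z),d_1(z),\dots,d_r(z))^T$, where $d_0,\dots,d_r$ are complex polynomials satisfying $$\deg d_k\le k\quad(0\le k\le r),\qquad \sum_{j=0}^r [n]_j\,d_{j,j}\ne 0\quad\text{for all } n\in\mathbb{Z}_+,$$ where $d_{j,l}$ is the coefficient of $z^l$ in $d_j$. Define $M_0(z)=G(z)G^*(z)$ and the matrix measure $M(\delta)=\int_\delta M_0(z)\,d\mu$, $\delta\in\mathfrak{B}(K)$. If complex polynomials are dense in $L^2_\mu$, then complex polynomials are dense in the Sobolev space $W^2(M)$ with the matrix measure $M$. In particular, if $K=\mathbb{T}=\{z\in\mathbb{C}:|z|=1\}$ and $\mu$ is nontrivial, then the condition $$\int_0^{2\pi}\log w(\theta)\,\frac{d\theta}{2\pi}=-\infty$$ is sufficient for the density of polynomials in the corresponding space $W^2(M)$. Here $w=2\pi\, d\mu_{ac}/d\theta$, where $\mu_{ac}$ is the absolutely continuous part of $\mu$ (with the identification $z=e^{i\theta}$).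
   Context: $\mathbb{Z}_+$ is the set of non-negative integers. For a complex number $c$: $[c]_0=1$, $[c]_k=c(c-1)\cdots(c-k+1)$, $k\in\mathbb{N}$. A star denotes the adjoint (conjugate transpose) matrix. The zero polynomial satisfies any bound $\deg\le k$. $L^2_\mu$ is the usual space of (classes of) complex Borel measurable functions $f$ on $K$ with $\int_K|f|^2d\mu<\infty$. A measure on $\mathbb{T}$ is nontrivial if its support is an infinite set. Space $L^2(M)$: let $M=(m_{k,l})_{k,l=0}^{\rho}$ be a non-negative Hermitian $(\rho+1)\times(\rho+1)$ matrix-valued function on $\mathfrak{B}(K)$ with countably additive entries (here $\rho=r$). Let $\tau=\sum_{k=0}^\rho m_{k,k}$ be the trace measure and $M'_\tau=dM/d\tau$ the entrywise Radon–Nikodym derivative. $L^2(M)$ is the Hilbert space of (classes of) measurable row-vector-valued functions $\vec f=(f_0,\dots,f_\rho):K\to\mathbb{C}^{\rho+1}$ with $\|\vec f\|^2_{L^2(M)}=\int_K\vec f M'_\tau\vec f^{\,*}\,d\tau<\infty$, with scalar product $(\vec f,\vec g)=\int_K\vec f M'_\tau\vec g^{\,*}\,d\tau$; two functions are identified if the norm of their difference is $0$. For $M$ as in the claim, these integrals equal $\int_K\vec f M_0\vec g^{\,*}\,d\mu$. $A^2(M)$ is the linear manifold in $L^2(M)$ of those classes which possess a representative of the form $\vec f(z)=(f(z),f'(z),\dots,f^{(\rho)}(z))$, where $f$ is a complex function on $K$ and primes denote derivatives with respect to $z$ (for a polynomial, its ordinary derivatives). $W^2(M)$, the Sobolev space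 with the matrix measure $M$, is the closure of $A^2(M)$ in the norm of $L^2(M)$. A polynomial $p$ is regarded as the element $(p,p',\dots,p^{(\rho)})$ of $A^2(M)$. *)

(* Defs.v *)
From HB Require Import structures.
From mathcomp Require Import all_boot all_order all_algebra.
From mathcomp Require Import all_classical all_reals all_analysis.
From mathcomp Require Import measurable_realfun complex.

Set Implicit Arguments.
Unset Strict Implicit.
Unset Printing Implicit Defensive.

Import Order.TTheory GRing.Theory Num.Theory.
Import numFieldNormedType.Exports.
Import Normc complex.

Local Open Scope classical_set_scope.
Local Open Scope charge_scope.
Local Open Scope sesquilinear_scope.
Local Open Scope ring_scope.

(* The Borel sigma-algebra of R[i] is generated by the open sets of the norm
   topology. *)
#[warnings="-redundant-canonical-projection"]
HB.instance Definition _ (R : realType) := NormedModule.copy R[i] R[i]^o.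
#[warnings="-redundant-canonical-projection"]
HB.instance Definition _ (R : realType) :=
  Measurable.copy R[i] (g_sigma_algebraType (@open R[i]^o)).

Section complex_borel.
Context {R : realType}.
Implicit Types z w : R[i].

Lemma normcEr z : `|z| = (normc z)%:C%C.
Proof. by case: z. Qed.

Lemma normc_ge0 z : 0 <= normc z.
Proof. by case: z => a b; exact: sqrtr_ge0. Qed.

Lemma Re_le_normc z : `|Re z| <= normc z.
Proof.
by case: z => a b /=; rewrite -sqrtr_sqr ler_wsqrtr// lerDl sqr_ge0.
Qed.

Lemma Im_le_normc z : `|Im z| <= normc z.
Proof.
by case: z => a b /=; rewrite -sqrtr_sqr ler_wsqrtr// lerDr sqr_ge0.
Qed.

Lemma Re_continuous : continuous (fun z => Re z).
Proof.
move=> z; apply: (cvgrPdist_lt (F := nbhs z) _ _).2 => e e0.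
have ec0 : 0 < e%:C%C by rewrite ltcR.
apply: (@filterS _ (nbhs z) (nbhs_filter z) (ball z e%:C%C)); last exact: nbhsx_ballx.
move=> w zw; rewrite -raddfB; apply: (le_lt_trans (Re_le_normc _)).
by rewrite -ltcR -normcEr.
Qed.

Lemma Im_continuous : continuous (fun z => Im z).
Proof.
move=> z; apply: (cvgrPdist_lt (F := nbhs z) _ _).2 => e e0.
have ec0 : 0 < e%:C%C by rewrite ltcR.
apply: (@filterS _ (nbhs z) (nbhs_filter z) (ball z e%:C%C)); last exact: nbhsx_ballx.
move=> w zw; rewrite -raddfB; apply: (le_lt_trans (Im_le_normc _)).
by rewrite -ltcR -normcEr.
Qed.

Lemma open_measurable_complex (A : set R[i]) : open A -> measurable A.
Proof. by move=> oA; apply: sub_sigma_algebra. Qed.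

Lemma continuous_measurable_fun_complex (f : R[i] -> R) :
  continuous f -> measurable_fun setT f.
Proof.
move=> /continuousP cf; apply: (measurability _ (RGenOpens.measurableE R)).
move=> _ [_ [a [b ->] <-]]; rewrite setTI.
by apply: open_measurable_complex; apply: cf; exact: interval_open.
Qed.

Lemma horner_continuous (p : {poly R[i]}) : continuous (fun z => p.[z]).
Proof.
elim/poly_ind: p => [|p c ih] z.
  by rewrite (_ : horner _ = cst 0); [exact: cst_continuous|
    apply/funext => w; rewrite horner0].
rewrite (_ : horner _ = (fun w => p.[w] * w + c)); last first.
  by apply/funext => w; rewrite !hornerE.
apply: (@continuousD R[i] R[i] R[i] (fun w => p.[w] * w) (cst c)); last exact: cst_continuous.
apply: (@continuousM R[i] R[i] (fun w => p.[w]) id); [exact: ih|by move=> ?; exact: cvg_id].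
Qed.

End complex_borel.
Section complex_integral.
Context d (T : measurableType d) (R : realType).
Variable mu : {measure set T -> \bar R}.
Implicit Types (A : set T) (f g : T -> R[i]).

Definition cintegrable A f :=
  mu.-integrable A (fun x => (Re (f x))%:E) /\
  mu.-integrable A (fun x => (Im (f x))%:E).

Definition cintegral A f : R[i] :=
  ((\int[mu]_(x in A) Re (f x)) +i* (\int[mu]_(x in A) Im (f x)))%C.

Lemma cintegrableS A B f : measurable A -> measurable B -> B `<=` A ->
  cintegrable A f -> cintegrable B f.
Proof.
move=> mA mB BA [f1 f2].
by split; [exact: integrableS f1|exact: integrableS f2].
Qed.

Lemma cintegrable0 A : cintegrable A (fun=> 0).
Proof. by split; exact: integrable0. Qed.

Lemma cintegrableD A f g : measurable A -> cintegrable A f -> cintegrable A g ->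
  cintegrable A (fun x => f x + g x).
Proof.
move=> mA [f1 f2] [g1 g2]; split.
  rewrite (_ : (fun x => _) = (fun x => (Re (f x))%:E + (Re (g x))%:E)%E).
    exact: integrableD.
  by apply/funext => x; rewrite raddfD.
rewrite (_ : (fun x => _) = (fun x => (Im (f x))%:E + (Im (g x))%:E)%E).
  exact: integrableD.
by apply/funext => x; rewrite raddfD.
Qed.

Lemma cintegralD A f g : measurable A -> cintegrable A f -> cintegrable A g ->
  cintegral A (fun x => f x + g x) = cintegral A f + cintegral A g.
Proof.
move=> mA [f1 f2] [g1 g2]; rewrite /cintegral.
apply/eqP; rewrite eq_complex /=; apply/andP; split; apply/eqP.
  by rewrite -RintegralD//; apply: eq_Rintegral => x _; rewrite raddfD.
by rewrite -RintegralD//; apply: eq_Rintegral => x _; rewrite raddfD.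
Qed.

Lemma cintegrable_sum A (I : Type) (s : seq I) (F : I -> T -> R[i]) :
  measurable A -> (forall i, cintegrable A (F i)) ->
  cintegrable A (fun x => \sum_(i <- s) F i x).
Proof.
move=> mA iF; elim: s => [|i s ih].
  rewrite (_ : (fun x => _) = (fun=> 0)); first exact: cintegrable0.
  by apply/funext => x; rewrite big_nil.
rewrite (_ : (fun x => _) = (fun x => F i x + \sum_(i <- s) F i x)).
  exact: cintegrableD.
by apply/funext => x; rewrite big_cons.
Qed.

Lemma cintegral_sum A (I : Type) (s : seq I) (F : I -> T -> R[i]) :
  measurable A -> (forall i, cintegrable A (F i)) ->
  cintegral A (fun x => \sum_(i <- s) F i x) = \sum_(i <- s) cintegral A (F i).
Proof.
move=> mA iF; elim: s => [|i s ih].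
  rewrite big_nil (_ : (fun x => _) = (fun=> 0)); last first.
    by apply/funext => x; rewrite big_nil.
  by rewrite /cintegral/= !Rintegral_cst// !mul0r.
rewrite (_ : (fun x => _) = (fun x => F i x + \sum_(i <- s) F i x)); last first.
  by apply/funext => x; rewrite big_cons.
by rewrite cintegralD ?ih ?big_cons//; exact: cintegrable_sum.
Qed.

Lemma cintegrableZl A (c : R[i]) f : measurable A -> cintegrable A f ->
  cintegrable A (fun x => c * f x).
Proof.
case: c => a b mA [f1 f2]; split.
  rewrite (_ : (fun x => _) =
      (fun x => a%:E * (Re (f x))%:E - b%:E * (Im (f x))%:E)%E).
    by apply: integrableB => //; exact: integrableZl.
  by apply/funext => x; case: (f x).
rewrite (_ : (fun x => _) =
    (fun x => a%:E * (Im (f x))%:E + b%:E * (Re (f x))%:E)%E).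
  by apply: integrableD => //; exact: integrableZl.
by apply/funext => x; case: (f x).
Qed.

Lemma cintegralZl A (c : R[i]) f : measurable A -> cintegrable A f ->
  cintegral A (fun x => c * f x) = c * cintegral A f.
Proof.
case: c => a b mA [f1 f2].
have iZ (e : R) h : mu.-integrable A (fun x => (h x)%:E) ->
    mu.-integrable A (EFin \o (fun x => e * h x)).
  by move=> ih; exact: (integrableZl mA e ih).
rewrite /cintegral; apply/eqP; rewrite eq_complex /=.
rewrite -!RintegralZl// -RintegralB ?iZ// -RintegralD ?iZ//.
by apply/andP; split; apply/eqP; apply: eq_Rintegral => x _; case: (f x).
Qed.

Lemma cintegral_conj A f : measurable A -> cintegrable A f ->
  cintegral A (fun x => (f x)^*%C) = ((cintegral A f)^*)%C.
Proof.
move=> mA [f1 f2]; rewrite /cintegral; apply/eqP; rewrite eq_complex /=.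
rewrite -mulN1r -RintegralZl//.
by apply/andP; split; apply/eqP; apply: eq_Rintegral => x _;
   case: (f x) => //= a b; rewrite mulN1r.
Qed.

Lemma cintegral_ge0 A f : (forall x, 0 <= f x) -> 0 <= cintegral A f.
Proof.
move=> f0; rewrite lecE /=; apply/andP; split.
  rewrite (@eq_Rintegral _ _ _ _ _ (cst 0)).
    by rewrite /Rintegral integral0.
  by move=> x _ /=; have := f0 x; rewrite lecE => /andP[/eqP ->].
by apply: Rintegral_ge0 => x _; have := f0 x; rewrite lecE => /andP[].
Qed.

End complex_integral.

Section matrix_measure.
Context d (T : measurableType d) (R : realType) (n : nat).

Definition nonneg_hermitian (A : 'M[R[i]]_n) :=
  A ^t* = A /\ forall v : 'rV[R[i]]_n, 0 <= (v *m A *m v ^t*) 0 0.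

(* Countable additivity of a complex set function is that of its real and
   imaginary parts. *)
Record matrix_measure := MatrixMeasure {
  mmeasure :> set T -> 'M[R[i]]_n ;
  mmeasure0 : mmeasure set0 = 0 ;
  mmeasure_sigma_additive_Re : forall k l,
    semi_sigma_additive (fun A => (Re (mmeasure A k l))%:E) ;
  mmeasure_sigma_additive_Im : forall k l,
    semi_sigma_additive (fun A => (Im (mmeasure A k l))%:E) ;
  mmeasure_nonneg_hermitian : forall A, measurable A ->
    nonneg_hermitian (mmeasure A) }.

Variable M : matrix_measure.

Definition mmeasure_Re k l (A : set T) : \bar R := (Re (M A k l))%:E.
Definition mmeasure_Im k l (A : set T) : \bar R := (Im (M A k l))%:E.

Lemma mmeasure_Re0 k l : mmeasure_Re k l set0 = 0%E.
Proof. by rewrite /mmeasure_Re mmeasure0 mxE. Qed.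

Lemma mmeasure_Im0 k l : mmeasure_Im k l set0 = 0%E.
Proof. by rewrite /mmeasure_Im mmeasure0 mxE. Qed.

Lemma mmeasure_Re_fin k l (A : set T) : measurable A ->
  mmeasure_Re k l A \is a fin_num.
Proof. by []. Qed.

Lemma mmeasure_Im_fin k l (A : set T) : measurable A ->
  mmeasure_Im k l A \is a fin_num.
Proof. by []. Qed.

HB.instance Definition _ k l := isCharge.Build d T R (mmeasure_Re k l)
  (mmeasure_Re0 k l) (@mmeasure_Re_fin k l)
  (@mmeasure_sigma_additive_Re M k l).

HB.instance Definition _ k l := isCharge.Build d T R (mmeasure_Im k l)
  (mmeasure_Im0 k l) (@mmeasure_Im_fin k l)
  (@mmeasure_sigma_additive_Im M k l).

(* The diagonal entries are real. The value 0 on non-measurable sets is only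
   there because the measures of the library are nonnegative on all sets. *)
Definition trace_measure (A : set T) : \bar R :=
  if `[< measurable A >] then (\sum_(k < n) Re (M A k k))%:E else 0%E.

Lemma mmeasure_diag_ge0 (A : set T) k : measurable A -> 0 <= Re (M A k k).
Proof.
move=> /(mmeasure_nonneg_hermitian M)[_ /(_ (delta_mx 0 k))].
rewrite (_ : (_ *m _ *m _) 0 0 = M A k k); first by rewrite lecE => /andP[].
rewrite -rowE mxE (bigD1 k)//= !mxE !eqxx conjC1 mulr1 big1 ?addr0// => i ik.
by rewrite !mxE (negbTE ik) andbF conjC0 mulr0.
Qed.

Lemma trace_measure0 : trace_measure set0 = 0%E.
Proof.
rewrite /trace_measure asboolT// big1// => k _.
by rewrite mmeasure0 mxE.
Qed.

Lemma trace_measure_ge0 A : (0 <= trace_measure A)%E.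
Proof.
rewrite /trace_measure; case: asboolP => // mA.
by rewrite lee_fin sumr_ge0// => k _; exact: mmeasure_diag_ge0.
Qed.

Lemma trace_measure_sigma_additive : semi_sigma_additive trace_measure.
Proof.
move=> F mF tF mUF.
rewrite (_ : (fun m => _) = (fun m =>
    (\sum_(k < n) (\sum_(0 <= i < m) mmeasure_Re k k (F i)))%E)); last first.
  apply/funext => m; rewrite exchange_big/=; apply: eq_bigr => i _.
  by rewrite /trace_measure asboolT// sumEFin.
rewrite /trace_measure asboolT// -sumEFin.
apply: cvg_nnesum => [k _|k _]; last exact: mmeasure_sigma_additive_Re.
by apply: nearW => m; apply: sume_ge0 => i _; rewrite lee_fin mmeasure_diag_ge0.
Qed.

HB.instance Definition _ := isMeasure.Build d T R trace_measure
  trace_measure0 trace_measure_ge0 trace_measure_sigma_additive.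

Lemma trace_measure_fin : fin_num_fun trace_measure.
Proof. by move=> A mA; rewrite /trace_measure asboolT. Qed.

HB.instance Definition _ := Measure_isFinite.Build d T R trace_measure
  trace_measure_fin.

(* M'_tau, the entrywise Radon-Nikodym derivative. *)
Definition trace_density (x : T) : 'M[R[i]]_n :=
  \matrix_(k, l)
    (fine ('d (mmeasure_Re k l) '/d trace_measure x) +i*
     fine ('d (mmeasure_Im k l) '/d trace_measure x))%C.

End matrix_measure.

Section density_mmeasure.
Context d (T : measurableType d) (R : realType) (n : nat).
Variables (mu : {measure set T -> \bar R}) (M0 : T -> 'M[R[i]]_n).
Hypothesis M0_integrable :
  forall k l, cintegrable mu setT (fun x => M0 x k l).
Hypothesis M0_nonneg : forall x, nonneg_hermitian (M0 x).

(* The matrix measure M(A) = \int_A M0 dmu. *)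
Definition density_mmeasure_val (A : set T) : 'M[R[i]]_n :=
  \matrix_(k, l) cintegral mu A (fun x => M0 x k l).

Let cintS A k l : measurable A -> cintegrable mu A (fun x => M0 x k l).
Proof. by move=> mA; apply: cintegrableS (M0_integrable k l). Qed.

Let density_mmeasure0 : density_mmeasure_val set0 = 0.
Proof. by apply/matrixP => k l; rewrite !mxE /cintegral !Rintegral_set0. Qed.

Let sigma_additive_Rintegral (f : T -> R) :
  mu.-integrable setT (fun x => (f x)%:E) ->
  semi_sigma_additive (fun A => (\int[mu]_(x in A) f x)%:E).
Proof.
move=> intf.
have E A : measurable A -> (\int[mu]_(x in A) f x)%:E = induced_charge intf A.
  by move=> mA; rewrite /Rintegral fineK// integrable_fin_num//; exact: integrableS intf.
move=> F mF tF mUF; rewrite E//.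
rewrite (_ : (fun m => _) =
    (fun m => \sum_(0 <= i < m) induced_charge intf (F i))%E); last first.
  by apply/funext => m; apply: eq_bigr => i _; rewrite E.
exact: (charge_semi_sigma_additive (s := induced_charge intf)).
Qed.

Let density_mmeasure_Re k l :
  semi_sigma_additive (fun A => (Re (density_mmeasure_val A k l))%:E).
Proof.
rewrite (_ : (fun A => _) = (fun A => (\int[mu]_(x in A) Re (M0 x k l))%:E)).
  by apply: sigma_additive_Rintegral; case: (M0_integrable k l).
by apply/funext => A; rewrite mxE.
Qed.

Let density_mmeasure_Im k l :
  semi_sigma_additive (fun A => (Im (density_mmeasure_val A k l))%:E).
Proof.
rewrite (_ : (fun A => _) = (fun A => (\int[mu]_(x in A) Im (M0 x k l))%:E)).
  by apply: sigma_additive_Rintegral; case: (M0_integrable k l).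
by apply/funext => A; rewrite mxE.
Qed.

Let density_mmeasure_nonneg A : measurable A ->
  nonneg_hermitian (density_mmeasure_val A).
Proof.
move=> mA; split.
  apply/matrixP => k l; rewrite !mxE -[LHS]/((_)^*%C).
  rewrite -(cintegral_conj mA (cintS l k mA)).
  rewrite (_ : (fun x => (M0 x l k)^*%C) = (fun x => M0 x k l))//.
  apply/funext => x.
  by have [/matrixP/(_ k l) + _] := M0_nonneg x; rewrite !mxE.
move=> v.
suff -> : (v *m density_mmeasure_val A *m v ^t*) 0 0 =
    cintegral mu A (fun x => (v *m M0 x *m v ^t*) 0 0).
  by apply: cintegral_ge0 => x; exact: (M0_nonneg x).2.
rewrite (_ : (fun x => (v *m M0 x *m v ^t*) 0 0) = (fun x =>
    \sum_(l < n) (v ^t*) l 0 * \sum_(k < n) v 0 k * M0 x k l)); last first.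
  apply/funext => x; rewrite mxE; apply: eq_bigr => l _.
  by rewrite mulrC; congr (_ * _); rewrite mxE.
have i1 l : cintegrable mu A (fun x => \sum_(k < n) v 0 k * M0 x k l).
  by apply: cintegrable_sum => // k; apply: cintegrableZl => //; exact: cintS.
rewrite cintegral_sum//; last by move=> l; exact: cintegrableZl.
rewrite mxE; apply: eq_bigr => l _; rewrite cintegralZl// mulrC; congr (_ * _); rewrite mxE.
rewrite cintegral_sum//; last by move=> k; apply: cintegrableZl => //; exact: cintS.
by apply: eq_bigr => k _; rewrite cintegralZl ?[density_mmeasure_val _ _ _]mxE//; exact: cintS.
Qed.

Definition density_mmeasure : matrix_measure T R n :=
  MatrixMeasure density_mmeasure0 density_mmeasure_Re density_mmeasure_Im
    density_mmeasure_nonneg.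

End density_mmeasure.

(* [D] is a dense subset of [A] for the distance N (x - y). *)
Definition dense_for (R : realType) (X : zmodType) (N : X -> \bar R)
    (D A : set X) :=
  D `<=` A /\ forall x, A x -> forall e : R, 0 < e ->
    exists2 y, D y & (N (x - y)%R < e%:E)%E.

(* L^2_mu and L^2(M) are represented by functions instead of classes: x and y
   are in the same class when N (x - y) = 0, N being the (semi)norm. Functions
   on K are total functions of which only the values on K matter. *)
Section spaces.
Context {R : realType}.
Local Notation C := R[i].
Variable K : set C.

Section L2mu.
Variable mu : {measure set C -> \bar R}.

Definition normL2 (f : C -> C) : \bar R :=
  sqrte (\int[mu]_(z in K) ((normc (f z)) ^+ 2)%:E).

Definition L2 : set (C -> C) :=
  [set f : C -> C | measurable_fun K f /\ (normL2 f < +oo)%E].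

End L2mu.

Section L2M.
Variables (r : nat) (M : matrix_measure C R r.+1).
Local Notation rowfun := (C -> 'rV[C]_r.+1).

(* The integrand F M'_tau F^* is real and nonnegative tau-almost everywhere. *)
Definition normL2M (F : rowfun) : \bar R :=
  sqrte (\int[trace_measure M]_(z in K)
    (Re ((F z *m trace_density M z *m (F z) ^t*) 0 0))%:E).

Definition L2M : set rowfun :=
  [set F : rowfun | (forall k, measurable_fun K (fun z => F z 0 k)) /\
                    (normL2M F < +oo)%E].

(* F = (f, f', ..., f^(r)) on K, the derivatives of f : K -> C being limits of
   difference quotients along K. At an isolated point of K the limit condition
   is void, so the ordinary derivatives of a polynomial are always allowed. *)
Definition derivative_row (F : rowfun) :=
  forall k l : 'I_r.+1, l = k.+1 :> nat -> forall z, K z ->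
    (F w 0 k - F z 0 k) / (w - z) @[w --> within K z^'] --> F z 0 l.

Definition A2 : set rowfun :=
  [set F : rowfun | L2M F /\ exists G,
    [/\ L2M G, derivative_row G & normL2M (F - G) = 0%E]].

(* The closure of A2 in L2M. *)
Definition W2 : set rowfun :=
  [set F : rowfun | L2M F /\ forall e : R, 0 < e ->
    exists2 G, A2 G & (normL2M (F - G)%R < e%:E)%E].

End L2M.
End spaces.

Section polynomials.
Context {R : realType}.
Local Notation C := R[i].

Definition polys : set (C -> C) :=
  [set f : C -> C | exists p : {poly C}, f = (fun z => p.[z])].

Definition poly_row (r : nat) (p : {poly C}) (z : C) : 'rV[C]_r.+1 :=
  \row_k (p^`(k)).[z].

Definition poly_rows (r : nat) : set (C -> 'rV[C]_r.+1) :=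
  [set F : C -> 'rV[C]_r.+1 | exists p : {poly C}, F = poly_row r p].

End polynomials.

Arguments poly_rows {R} r _.

(* A measure on the Borel subsets of K is a Borel measure mu on the plane with
   mu (~` K) = 0. *)
Section sobolev_measure.
Context {R : realType}.
Local Notation C := R[i].
Variable K : set C.
Hypothesis mK : measurable K.
Variable mu : {finite_measure set C -> \bar R}.

Definition finite_moments :=
  forall j, (\int[mu]_(z in K) ((normc z) ^+ j)%:E < +oo)%E.

Hypothesis muK : mu (~` K) = 0%E.
Hypothesis momK : finite_moments.
Variables (r : nat) (d : 'I_r.+1 -> {poly C}).

(* G and M0 = G G^* *)
Definition poly_col (z : C) : 'cV[C]_r.+1 := \col_k (d k).[z].
Definition poly_gram (z : C) : 'M[C]_r.+1 := poly_col z *m (poly_col z) ^t*.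

Lemma poly_gram_nonneg z : nonneg_hermitian (poly_gram z).
Proof.
rewrite /poly_gram; move: (poly_col z) => g; split.
  by rewrite trmx_mul map_mxM /= trmxCK.
move=> v; rewrite mulmxA -mulmxA.
rewrite (_ : g ^t* *m v ^t* = (v *m g) ^t*); last by rewrite trmx_mul map_mxM.
by rewrite mxE big_ord1 !mxE mul_conjC_ge0.
Qed.

Let measurable_Re_poly (p : {poly C}) : measurable_fun setT (fun z => Re p.[z]).
Proof.
apply: continuous_measurable_fun_complex => z.
exact: (@continuous_comp R[i] R[i] R (fun w => p.[w]) (fun w => Re w) z
  (@horner_continuous _ p z) (@Re_continuous _ p.[z])).
Qed.

Let measurable_Im_poly (p : {poly C}) : measurable_fun setT (fun z => Im p.[z]).
Proof.
apply: continuous_measurable_fun_complex => z.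
exact: (@continuous_comp R[i] R[i] R (fun w => p.[w]) (fun w => Im w) z
  (@horner_continuous _ p z) (@Im_continuous _ p.[z])).
Qed.

Let measurable_normc_poly (p : {poly C}) :
  measurable_fun setT (fun z => normc p.[z]).
Proof.
rewrite (_ : (fun z => _) =
   (fun z => Num.sqrt (Re p.[z] ^+ 2 + Im p.[z] ^+ 2))); last first.
  by apply/funext => z; case: p.[z].
apply: (measurableT_comp (continuous_measurable_fun (@sqrt_continuous R))).
by apply: measurable_funD; apply: measurable_funX.
Qed.

Let integrable_moment j :
  mu.-integrable setT (fun z => ((normc z) ^+ j)%:E).
Proof.
have mf : measurable_fun setT (fun z : C => ((normc z) ^+ j)%:E).
  apply/measurable_EFinP; apply: measurable_funX.
  by have := measurable_normc_poly 'X; under eq_fun do rewrite hornerX.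
apply/(negligible_integrable (measurableC mK)) => //.
rewrite setTD setCK; apply/integrableP; split; first exact: measurable_funTS.
apply: le_lt_trans (momK j); apply: ge0_le_integral => //.
- by apply: measurableT_comp => //; exact: measurable_funTS.
- exact: measurable_funTS.
- by move=> z _; rewrite gee0_abs// lee_fin exprn_ge0 ?normc_ge0.
Qed.

Let integrable_normc_poly (p : {poly C}) :
  mu.-integrable setT (fun z => (normc p.[z])%:E).
Proof.
apply: (le_integrable measurableT (g := fun z =>
   (\sum_(i < size p) (normc p`_i)%:E * ((normc z) ^+ i)%:E)%E)).
- exact/measurable_EFinP.
- move=> z _; rewrite sumEFin !gee0_abs ?lee_fin ?normc_ge0//; last first.
    by apply: sumr_ge0 => i _; rewrite mulr_ge0 ?exprn_ge0 ?normc_ge0.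
  rewrite horner_coef; elim/big_ind2 : _ => [|a b x y ab xy|i _].
  + by rewrite normc0.
  + by apply: (le_trans (le_normcD _ _)); exact: lerD.
  + rewrite normcM ler_wpM2l ?normc_ge0//.
    by elim: (nat_of_ord i) => [|m ih]; rewrite ?expr0 ?normc1// !exprS normcM ler_wpM2l ?normc_ge0.
- by apply: integrable_sum => // i _; apply: integrableZl.
Qed.

Let poly_gramE z k l : poly_gram z k l = (d k).[z] * ((d l).[z])^*%C.
Proof. by rewrite mxE big_ord1 !mxE. Qed.

Lemma poly_gram_integrable k l :
  cintegrable mu setT (fun z => poly_gram z k l).
Proof.
have nE z : normc (poly_gram z k l) = normc ((d k * d l).[z]).
  by rewrite poly_gramE hornerM !normcM; congr (_ * _);
     case: (d l).[z] => a b /=; rewrite sqrrN.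
split; apply: (le_integrable measurableT _ _ (integrable_normc_poly (d k * d l))).
- apply/measurable_EFinP.
  rewrite (_ : (fun z => _) = (fun z => Re (d k).[z] * Re (d l).[z] +
      Im (d k).[z] * Im (d l).[z])); last first.
    apply/funext => z; rewrite poly_gramE.
    by case: (d k).[z] (d l).[z] => a b [a' b'] /=; rewrite mulrN opprK.
  by apply: measurable_funD; apply: measurable_funM.
- move=> z _; rewrite [leRHS]gee0_abs ?lee_fin ?normc_ge0// -nE.
  exact: Re_le_normc.
- apply/measurable_EFinP.
  rewrite (_ : (fun z => _) = (fun z => Im (d k).[z] * Re (d l).[z] -
      Re (d k).[z] * Im (d l).[z])); last first.
    apply/funext => z; rewrite poly_gramE.
    by case: (d k).[z] (d l).[z] => a b [a' b'] /=; rewrite mulrN addrC.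
  by apply: measurable_funB; apply: measurable_funM.
- move=> z _; rewrite [leRHS]gee0_abs ?lee_fin ?normc_ge0// -nE.
  exact: Im_le_normc.
Qed.

(* M(A) = \int_A M0 dmu *)
Definition sobolev_measure : matrix_measure C R r.+1 :=
  density_mmeasure poly_gram_integrable poly_gram_nonneg.

End sobolev_measure.

Section circle.
Context {R : realType}.
Local Notation C := R[i].

Definition unit_circle : set C := [set z | `|z| = 1].

Definition msupport (mu : {measure set C -> \bar R}) : set C :=
  [set z | forall U : set C, open U -> U z -> (0 < mu U)%E].

Definition expi (t : R) : C := (cos t +i* sin t)%C.

Lemma expi_continuous : continuous expi.
Proof.
move=> t; apply: (cvgrPdist_lt (F := nbhs t) _ _).2 => -[e e'].
rewrite ltcE /= => /andP[/eqP-> e0].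
have e20 : 0 < e / 2 by rewrite divr_gt0.
have normc_le (a b : R) : normc (a +i* b)%C <= `|a| + `|b|.
  rewrite (_ : (a +i* b)%C = (a +i* 0)%C + (0 +i* b)%C); last first.
    by apply/eqP; rewrite eq_complex /= addr0 add0r !eqxx.
  by rewrite (le_trans (le_normcD _ _))//= expr0n/= addr0 add0r !sqrtr_sqr.
near=> u.
rewrite normcEr ltcR (le_lt_trans (normc_le _ _))// [ltRHS]splitr ltrD//.
  by near: u; move/cvgrPdist_lt: (@continuous_cos R t); exact.
by near: u; move/cvgrPdist_lt: (@continuous_sin R t); exact.
Unshelve. all: by end_near. Qed.

Lemma measurable_expi : measurable_fun setT (expi : measurableTypeR R -> C).
Proof.
have mC : (measurable : set (set C)) = <<s @open C >> by [].
apply: (measurability _ mC).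
move=> _ [U oU <-].
rewrite setTI; apply: open_measurable.
by move/continuousP: expi_continuous; exact.
Qed.

(* The arc length measure dtheta, on the Borel subsets of the plane. *)
Definition arc_length : set C -> \bar R :=
  pushforward (mrestr lebesgue_measure (measurable_itv `[0, (2 * pi)[)) expi.

Lemma arc_length0 : arc_length set0 = 0%E.
Proof. by rewrite /arc_length /pushforward preimage_set0 measure0. Qed.

Lemma arc_length_ge0 A : (0 <= arc_length A)%E.
Proof. by rewrite /arc_length /pushforward measure_ge0. Qed.

Lemma arc_length_sigma_additive : semi_sigma_additive arc_length.
Proof.
have mexpi A : measurable A -> measurable (expi @^-1` A : set (measurableTypeR R)).
  by move=> mA; rewrite -[X in measurable X]setTI; exact: measurable_expi.
move=> F mF tF mUF; rewrite /arc_length /pushforward preimage_bigcup.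
apply: measure_semi_sigma_additive => [n||]; first exact: mexpi.
- apply/trivIsetP => /= i j _ _ ij; rewrite -preimage_setI.
  by move/trivIsetP : tF => /(_ _ _ _ _ ij) ->//; rewrite preimage_set0.
- by rewrite -preimage_bigcup; exact: mexpi.
Qed.

HB.instance Definition _ := isMeasure.Build _ C R arc_length
  arc_length0 arc_length_ge0 arc_length_sigma_additive.

Lemma arc_length_fin : fin_num_fun arc_length.
Proof.
apply: lty_fin_num_fun.
rewrite [ltLHS](_ : _ = lebesgue_measure (`[0, (2 * pi)%R[%classic : set R)).
by rewrite lebesgue_measure_itv/=; case: ifP => _; rewrite ?ltry// -EFinB ltry.
by change (lebesgue_measure (expi @^-1` setT `&` `[0, (2 * pi)%R[ : set R) = lebesgue_measure (`[0, (2 * pi)%R[%classic : set R)); rewrite preimage_setT setTI.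
Qed.

HB.instance Definition _ := Measure_isFinite.Build _ C R arc_length
  arc_length_fin.

(* [mu_ac] is the absolutely continuous part of the Lebesgue decomposition of
   [mu] with respect to [nu]. *)
Definition ac_part (nu mu mu_ac : {finite_measure set C -> \bar R}) :=
  mu_ac `<< nu /\ exists mu_s : {finite_measure set C -> \bar R},
    (exists N, [/\ measurable N, nu N = 0%E & mu_s (~` N) = 0%E]) /\
    forall A, measurable A -> mu A = (mu_ac A + mu_s A)%E.

(* w = 2 pi d(mu_ac)/dtheta *)
Definition szego_weight (mu_ac : {finite_measure set C -> \bar R}) (t : R) :
  \bar R := ((2 * pi)%:E * ('d (charge_of_finite_measure mu_ac) '/d arc_length) (expi t))%E.

End circle.

(* Main.v *)
Require Import Defs.
From HB Require Import structures.
From mathcomp Require Import all_boot all_order all_algebra.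
From mathcomp Require Import all_classical all_reals all_analysis.
From mathcomp Require Import measurable_realfun complex.
From mathcomp Require Import ring lra.

Import Order.TTheory GRing.Theory Num.Theory.
Import numFieldNormedType.Exports.
Local Open Scope classical_set_scope.
Local Open Scope ring_scope.

(** The first part is an isometry. As [M_0 = G G^*], the form
    [F M_0 F^*] is the squared modulus of the scalar function [F G], and the
    trace density of [M] is [M_0 / |G|^2] almost everywhere; hence
    [F |-> F G] preserves the norms of [L^2(M)] and [L^2_mu]
    ([normL2M_gdot]). On the row of a polynomial [p] it gives
    [D p = sum_k d_k p^(k)]. The bound on the degrees makes [D] triangular in
    the basis of monomials, the nonvanishing sums are its diagonal entries, and
    so [D] maps the polynomials onto the polynomials ([diff_op_surj]). Density
    in [L^2_mu] therefore gives density in all of [L^2(M)], a fortiori in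
    [W^2(M)] ([dense_poly_rows]).

    The second part needs the sufficiency half of the theorem of Szego,
    Kolmogorov and Krein: on the circle, polynomials are dense in [L^2_mu] as
    soon as [log w] has integral [-oo]. Let [e] be a lower bound of
    [int |1 - z q|^2 dmu] over all polynomials [q], that is, of the squared
    distance from [conj z] to the polynomials. If [h] is a polynomial with
    [h(0) = 0] then [(1 + h/n)^n] takes the value 1 at 0 and its squared
    modulus tends to [exp (2 Re h)], so that
    [e exp (mean L) <= int exp L dmu] for [L] the real part of a polynomial,
    where [mean] is the average over the circle. Both sides are stable under
    bounded pointwise limits, and every bounded Borel function on the circle is
    obtained from such [L] by iterating these limits; hence the inequality
    holds for all bounded Borel functions [L] ([mean_bound_bounded]). Taking
    for [L] the truncations of [- log w], lowered to [- n] on a null set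
    carrying the singular part, keeps the right-hand side bounded while the
    mean tends to [+oo]; so [e <= 0] ([conj_approx_szego]). Thus [conj z] is a
    limit of polynomials. Multiplication by [conj z] is isometric on the
    circle, so the closure of the polynomials contains their conjugates, then
    all bounded Borel functions by the same limit argument, then [L^2_mu]
    ([approx_L2]). *)

Set Implicit Arguments.
Unset Strict Implicit.
Unset Printing Implicit Defensive.

Import Normc complex.

(** * Borel sets and measurable functions of the complex plane *)
Section plane.
Context {R : realType}.
Local Notation C := R[i].

Definition half_planes : set (set C) :=
  [set A | exists a : R, A = [set z | a < Re z] \/ A = [set z | Re z < a] \/
                         A = [set z | a < Im z] \/ A = [set z | Im z < a]].

Lemma Re_add (z w : C) : Re (z + w) = Re z + Re w. Proof. by case: z w => ? ? []. Qed.
Lemma Im_add (z w : C) : Im (z + w) = Im z + Im w. Proof. by case: z w => ? ? []. Qed.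
Lemma Re_sub (z w : C) : Re (z - w) = Re z - Re w. Proof. by case: z w => ? ? []. Qed.
Lemma Im_sub (z w : C) : Im (z - w) = Im z - Im w. Proof. by case: z w => ? ? []. Qed.

(** An open set is the union of the rectangles with rational sides that it
    contains; there are countably many of them. *)
Lemma open_half_planes (U : set C) : open U -> <<s half_planes >> U.
Proof.
move=> oU.
pose box (q1 q2 q3 q4 : rat) : set C :=
  [set z | [/\ ratr q1 < Re z, Re z < ratr q2, ratr q3 < Im z & Im z < ratr q4]].
pose T := g_sigma_algebraType half_planes.
have mbox q1 q2 q3 q4 : (measurable (box q1 q2 q3 q4 : set T)).
  rewrite (_ : box _ _ _ _ =
    [set z : C | ratr q1 < Re z] `&` [set z : C | Re z < ratr q2] `&`
    [set z : C | ratr q3 < Im z] `&` [set z : C | Im z < ratr q4]); last first.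
    by apply/seteqP; split => z /= => [[? ? ? ?]|[[[? ?] ?] ?]].
  by do 3?[apply: measurableI]; apply: sub_sigma_algebra; eexists;
    [left|right; left|do 2 right; left|do 3 right].
rewrite (_ : U = \bigcup_(q1 : rat) \bigcup_(q2 : rat) \bigcup_(q3 : rat)
    \bigcup_(q4 : rat) (if `[< box q1 q2 q3 q4 `<=` U >] then box q1 q2 q3 q4 else set0)).
  do 4![apply: (@bigcupT_measurable_rat _ T) => ?].
  by case: ifP.
apply/seteqP; split => z; last first.
  by move=> [q1 _ [q2 _ [q3 _ [q4 _]]]]; case: asboolP => // + ?; exact.
move=> Uz; have := @open_nbhs_nbhs _ z U (conj oU Uz).
rewrite -nbhs_ballE => -[[e e'] /=]; rewrite ltcE /= => /andP[/eqP -> e0 eU].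
have e20 : 0 < e / 2 by rewrite divr_gt0.
have aux (x : R) : exists q1 q2 : rat,
    [/\ x - e / 2 < ratr q1, ratr q1 < x, x < ratr q2 & ratr q2 < x + e / 2].
  have /rat_in_itvoo[q1] : x - e / 2 < x by rewrite ltrBlDr ltrDl.
  have /rat_in_itvoo[q2] : x < x + e / 2 by rewrite ltrDl.
  by rewrite !in_itv/= => /andP[? ?] /andP[? ?]; exists q1, q2.
have [q1 [q2 [h1 h2 h3 h4]]] := aux (Re z).
have [q3 [q4 [h5 h6 h7 h8]]] := aux (Im z).
exists q1 => //; exists q2 => //; exists q3 => //; exists q4 => //.
rewrite asboolT//= => w [w1 w2 w3 w4]; apply: eU.
rewrite /= -ball_normE /ball_ /= normcEr ltcR.
have : `|Re (z - w)| < e / 2 by rewrite Re_sub ltr_norml; apply/andP; split; lra.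
have : `|Im (z - w)| < e / 2 by rewrite Im_sub ltr_norml; apply/andP; split; lra.
case: (z - w) => a b /= hb ha.
rewrite -(ltr_pXn2r (n := 2)) ?nnegrE ?sqrtr_ge0 ?(ltW e0)// sqr_sqrtr ?addr_ge0 ?sqr_ge0//.
rewrite -(real_normK (num_real a)) -(real_normK (num_real b)).
have := normr_ge0 a; have := normr_ge0 b; nra.
Qed.

Lemma borel_half_planes : (@measurable _ C : set (set C)) = <<s half_planes >>.
Proof.
apply/seteqP; split.
  rewrite [measurable](_ : _ = <<s @open C >>)//.
  apply: smallest_sub; first exact: smallest_sigma_algebra.
  exact: open_half_planes.
apply: smallest_sub; first exact: sigma_algebra_measurable.
have opre (f : C -> R) (A : set R) : continuous f -> open A -> measurable (f @^-1` A).
  by move=> /continuousP cf oA; apply: open_measurable_complex; exact: cf.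
move=> _ [a [|[|[|]]] ->].
- have := opre _ [set x | a < x] Re_continuous; apply; exact: open_gt.
- have := opre _ [set x | x < a] Re_continuous; apply; exact: open_lt.
- have := opre _ [set x | a < x] Im_continuous; apply; exact: open_gt.
- have := opre _ [set x | x < a] Im_continuous; apply; exact: open_lt.
Qed.

Section measurability.
Context d (T : measurableType d).
Implicit Types (D : set T) (f g : T -> C).

Lemma measurable_Re D f : measurable_fun D f -> measurable_fun D (fun x => Re (f x)).
Proof.
by apply: measurableT_comp; apply: continuous_measurable_fun_complex; exact: Re_continuous.
Qed.

Lemma measurable_Im D f : measurable_fun D f -> measurable_fun D (fun x => Im (f x)).
Proof.
by apply: measurableT_comp; apply: continuous_measurable_fun_complex; exact: Im_continuous.
Qed.

(** Half-planes bound either [Re] or [Im] alone, so their preimages are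
    controlled by one coordinate. *)
Lemma measurable_ReIm D f : measurable_fun D (fun x => Re (f x)) ->
  measurable_fun D (fun x => Im (f x)) -> measurable_fun D f.
Proof.
move=> mR mI mD; apply: (measurability _ borel_half_planes) => //.
move=> _ [_ [a [|[|[|]]] ->] <-].
- by rewrite [X in measurable X](_ : _ = D `&` (fun x => Re (f x)) @^-1` `]a, +oo[);
    [exact: mR|apply/seteqP; split => x /=; rewrite in_itv/= andbT].
- by rewrite [X in measurable X](_ : _ = D `&` (fun x => Re (f x)) @^-1` `]-oo, a[);
    [exact: mR|apply/seteqP; split => x /=; rewrite in_itv/=].
- by rewrite [X in measurable X](_ : _ = D `&` (fun x => Im (f x)) @^-1` `]a, +oo[);
    [exact: mI|apply/seteqP; split => x /=; rewrite in_itv/= andbT].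
- by rewrite [X in measurable X](_ : _ = D `&` (fun x => Im (f x)) @^-1` `]-oo, a[);
    [exact: mI|apply/seteqP; split => x /=; rewrite in_itv/=].
Qed.

Lemma measurable_cD D f g : measurable_fun D f -> measurable_fun D g ->
  measurable_fun D (fun x => f x + g x).
Proof.
move=> mf mg; apply: measurable_ReIm.
  under eq_fun do rewrite Re_add.
  by apply: measurable_funD; exact: measurable_Re.
under eq_fun do rewrite Im_add.
by apply: measurable_funD; exact: measurable_Im.
Qed.

Lemma Re_mul (z w : C) : Re (z * w) = Re z * Re w - Im z * Im w.
Proof. by case: z w => ? ? []. Qed.
Lemma Im_mul (z w : C) : Im (z * w) = Re z * Im w + Im z * Re w.
Proof. by case: z w => ? ? []. Qed.

Lemma measurable_cM D f g : measurable_fun D f -> measurable_fun D g ->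
  measurable_fun D (fun x => f x * g x).
Proof.
move=> mf mg; apply: measurable_ReIm.
  under eq_fun do rewrite Re_mul.
  by apply: measurable_funB; apply: measurable_funM; (exact: measurable_Re || exact: measurable_Im).
under eq_fun do rewrite Im_mul.
by apply: measurable_funD; apply: measurable_funM; (exact: measurable_Re || exact: measurable_Im).
Qed.

Lemma measurable_csum D (I : Type) (s : seq I) (F : I -> T -> C) :
  (forall i, measurable_fun D (F i)) -> measurable_fun D (fun x => \sum_(i <- s) F i x).
Proof.
move=> mF; elim: s => [|i s ih].
  by under eq_fun do rewrite big_nil; exact: measurable_cst.
by under eq_fun do rewrite big_cons; exact: measurable_cD.
Qed.

End measurability.

Lemma measurable_horner (D : set C) (p : {poly C}) : measurable_fun D (fun z => p.[z]).
Proof.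
apply: (measurable_funS measurableT) => //.
apply: (measurability _ (erefl (@measurable _ C))) => _ [U oU <-].
rewrite setTI; apply: open_measurable_complex.
by move/continuousP : (@horner_continuous R p); exact.
Qed.

(** The squared modulus as a polynomial in the coordinates, so that its algebra
    and its measurability involve no square root. *)
Definition sqn (z : C) : R := Re z ^+ 2 + Im z ^+ 2.

Lemma normc_sqr z : normc z ^+ 2 = sqn z.
Proof. by case: z => a b; rewrite /sqn /= sqr_sqrtr// addr_ge0 ?sqr_ge0. Qed.

Lemma sqn_ge0 z : 0 <= sqn z. Proof. by rewrite addr_ge0 ?sqr_ge0. Qed.

Lemma sqnM z w : sqn (z * w) = sqn z * sqn w.
Proof. by rewrite /sqn Re_mul Im_mul; ring. Qed.

Lemma sqn_real (x : R) : sqn x%:C%C = x ^+ 2.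
Proof. by rewrite /sqn/= expr0n addr0. Qed.

Lemma sqnX z n : sqn (z ^+ n) = sqn z ^+ n.
Proof.
elim: n => [|n ih]; first by rewrite !expr0 /sqn/= expr0n addr0 expr1n.
by rewrite !exprS sqnM ih.
Qed.

Lemma sqnD z w : sqn (z + w) <= 2 * sqn z + 2 * sqn w.
Proof.
rewrite /sqn Re_add Im_add.
have := sqr_ge0 (Re z - Re w); have := sqr_ge0 (Im z - Im w); nra.
Qed.

Lemma measurable_sqn d (T : measurableType d) (D : set T) (f : T -> C) :
  measurable_fun D f -> measurable_fun D (fun x => sqn (f x)).
Proof.
by move=> mf; apply: measurable_funD; apply: measurable_funX;
  [exact: measurable_Re|exact: measurable_Im].
Qed.

End plane.

(** * Bounded pointwise limits and the monotone class theorem *)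
Section bpclosure.
Context d (T : measurableType d) (R : realType) (D : set T).

(** The least class of functions that contains [X] and is stable under uniformly
    bounded pointwise limits on [D]. Properties that dominated convergence
    carries from [X] to limits are then proved by induction, without choosing
    approximating sequences. *)
Inductive bpclosure (X : set (T -> R)) : (T -> R) -> Prop :=
| bp_sub f : X f -> bpclosure X f
| bp_lim (F : nat -> T -> R) (M : R) f :
    (forall n, bpclosure X (F n)) ->
    (forall n z, D z -> `|F n z| <= M) ->
    (forall z, D z -> F n z @[n --> \oo] --> f z) -> bpclosure X f.

Variable X : set (T -> R).
Hypothesis X_bounded : forall f, X f -> exists M, forall z, D z -> `|f z| <= M.
Hypothesis X_cst : forall c, X (cst c).
Hypothesis X_add : forall f g, X f -> X g -> exists2 h, X h & forall z, D z -> h z = f z + g z.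
Hypothesis X_mul : forall f g, X f -> X g -> exists2 h, X h & forall z, D z -> h z = f z * g z.
Local Notation bp := (bpclosure X).

Lemma bp_bounded f : bp f -> exists M, forall z, D z -> `|f z| <= M.
Proof.
elim=> {f} [f /X_bounded//|F M f _ _ FM Ff]; exists M => z Dz.
by apply: (cvgr_to_le (cvg_norm (Ff z Dz))); apply: nearW => n; exact: FM.
Qed.

Lemma bp_eq f g : bp f -> (forall z, D z -> g z = f z) -> bp g.
Proof.
move=> bf fg; have [M fM] := bp_bounded bf.
apply: (@bp_lim _ (fun=> f) M) => // z Dz.
by rewrite fg//; exact: cvg_cst.
Qed.

Section binary_operation.
Variable op : R -> R -> R.
Hypothesis op_bounded : forall M N, exists K, forall x y,
  `|x| <= M -> `|y| <= N -> `|op x y| <= K.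
Hypothesis op_cvgl : forall (u : R^nat) x y,
  u n @[n --> \oo] --> x -> op (u n) y @[n --> \oo] --> op x y.
Hypothesis op_cvgr : forall (u : R^nat) x y,
  u n @[n --> \oo] --> x -> op y (u n) @[n --> \oo] --> op y x.
Hypothesis X_op : forall f g, X f -> X g ->
  exists2 h, X h & forall z, D z -> h z = op (f z) (g z).

(** Separate continuity is enough: the induction on [g] for [f] in the closure
    starts from the induction on [f] for [g] in [X]. *)
Lemma bp_op f g : bp f -> bp g -> bp (fun z => op (f z) (g z)).
Proof.
move=> bf; elim=> {g} [g Xg|F M g bF ih FM Fg].
  elim: bf => {f} [f Xf|F M f bF ih FM Ff].
    have [h Xh hE] := X_op Xf Xg; apply: (bp_eq (bp_sub Xh)) => z Dz.
    by rewrite hE.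
  have [N gN] := X_bounded Xg; have [K opK] := op_bounded M N.
  apply: (bp_lim (M := K) ih) => [n z Dz|z Dz]; first by rewrite opK ?FM ?gN.
  by apply: op_cvgl; exact: Ff.
have [N fN] := bp_bounded bf; have [K opK] := op_bounded N M.
apply: (bp_lim (M := K) ih) => [n z Dz|z Dz]; first by rewrite opK ?FM ?fN.
by apply: op_cvgr; exact: Fg.
Qed.

End binary_operation.

Lemma bp_cst c : bp (cst c). Proof. exact/bp_sub. Qed.

Lemma bp_add f g : bp f -> bp g -> bp (fun z => f z + g z).
Proof.
apply: (@bp_op +%R) => //.
- move=> M N; exists (M + N) => x y xM yN.
  by rewrite (le_trans (ler_normD _ _))// lerD.
- by move=> u x y ux; apply: cvgD => //; exact: cvg_cst.
- by move=> u x y ux; apply: cvgD => //; exact: cvg_cst.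
Qed.

Lemma bp_mul f g : bp f -> bp g -> bp (fun z => f z * g z).
Proof.
apply: (@bp_op *%R) => //.
- move=> M N; exists (M * N) => x y xM yN.
  by rewrite normrM ler_pM.
- by move=> u x y ux; apply: cvgM => //; exact: cvg_cst.
- by move=> u x y ux; apply: cvgM => //; exact: cvg_cst.
Qed.

Lemma bp_scale c f : bp f -> bp (fun z => c * f z).
Proof. by move=> bf; apply: bp_mul => //; exact: bp_cst. Qed.

Lemma bp_sum (I : Type) (s : seq I) (F : I -> T -> R) :
  (forall i, bp (F i)) -> bp (fun z => \sum_(i <- s) F i z).
Proof.
move=> bF; elim: s => [|i s ih].
  by under eq_fun do rewrite big_nil; exact: bp_cst.
by under eq_fun do rewrite big_cons; exact: bp_add.
Qed.

(* On [-1, 1] the odd cubic x (3 - x^2) / 2 pushes every nonzero point away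
   from 0 towards 1 or -1, so its iterates are polynomials that converge
   boundedly to the sign function. *)
Let sgstep (x : R) := x * (3 - x ^+ 2) / 2.

Let sgstepN x : sgstep (- x) = - sgstep x.
Proof. by rewrite /sgstep sqrrN !mulNr. Qed.

Let sgstep_pos (a x : R) : 0 < a -> a <= x <= 1 ->
  a <= sgstep x <= 1 /\ 1 - sgstep x <= (1 - a / 2) * (1 - x).
Proof.
rewrite /sgstep => a0 /andP[ax x1]; split.
  have : 0 <= (1 - x) * (1 + x) * x by rewrite !mulr_ge0 ?subr_ge0//; lra.
  have : 0 <= (1 - x) ^+ 2 * (2 + x) by rewrite mulr_ge0 ?sqr_ge0//; lra.
  by move=> h1 h2; apply/andP; split; nra.
have : 0 <= (1 - x) * ((x - a) + x ^+ 2).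
  by rewrite mulr_ge0 ?subr_ge0// addr_ge0 ?sqr_ge0// subr_ge0.
nra.
Qed.

Let iter_sgstep_pos (x : R) n : 0 < x -> x <= 1 ->
  x <= iter n sgstep x <= 1 /\ 1 - iter n sgstep x <= (1 - x / 2) ^+ n.
Proof.
move=> x0 x1; elim: n => [|n [ih1 ih2]] /=.
  by rewrite lexx x1 expr0; split=> //; lra.
have [h1 h2] := sgstep_pos x0 ih1; split=> //.
apply: (le_trans h2); rewrite exprS ler_wpM2l//; lra.
Qed.

Let iter_sgstepN n x : iter n sgstep (- x) = - iter n sgstep x.
Proof. by elim: n => //= n ->; rewrite sgstepN. Qed.

Let iter_sgstep0 n : iter n sgstep 0 = 0.
Proof. by elim: n => //= n ->; rewrite /sgstep !mul0r. Qed.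

Let iter_sgstep_bound n x : `|x| <= 1 -> `|iter n sgstep x| <= 1.
Proof.
have pos y : 0 < y -> y <= 1 -> `|iter n sgstep y| <= 1.
  move=> y0 y1; have [/andP[h1 h2] _] := iter_sgstep_pos n y0 y1.
  by rewrite ger0_norm// (le_trans _ h1)// ltW.
have [x0|x0|->] := ltrgt0P x; last by rewrite iter_sgstep0 normr0.
- exact: pos.
- by move=> x1; rewrite -(opprK x) iter_sgstepN normrN pos// oppr_gt0.
Qed.

Let cvg_iter_sgstep x : `|x| <= 1 -> iter n sgstep x @[n --> \oo] --> Num.sg x.
Proof.
have pos y : 0 < y -> y <= 1 -> iter n sgstep y @[n --> \oo] --> (1 : R).
  move=> y0 y1.
  apply: (@squeeze_cvgr _ _ _ _ (fun n => 1 - (1 - y / 2) ^+ n) (cst 1)).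
  - apply: nearW => n; have [/andP[_ h1] h2] := iter_sgstep_pos n y0 y1.
    by rewrite h1 andbT; lra.
  - rewrite -[X in _ --> X]subr0; apply: cvgB; first exact: cvg_cst.
    by apply: cvg_expr; rewrite ger0_norm; lra.
  - exact: cvg_cst.
have [x0|x0|->] := ltrgt0P x => x1.
- by rewrite gtr0_sg//; exact: pos.
- rewrite ltr0_sg// -(opprK x); under eq_fun do rewrite iter_sgstepN.
  by apply: cvgN; apply: pos => //; rewrite oppr_gt0.
- by rewrite sgr0; under eq_fun do rewrite iter_sgstep0; exact: cvg_cst.
Qed.

(** The indicator of [f > 0] is [(sg f + sg f ^ 2) / 2], and [sg f] is a bounded
    limit of polynomials in [f]. *)
Lemma bp_indic_gt0 f : bp f -> bp (\1_[set z | 0 < f z]).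
Proof.
move=> bf; have [M0 fM0] := bp_bounded bf.
pose M := Num.max 1 M0.
have M1 : 0 < M by rewrite lt_max ltr01.
have fM z : D z -> `|M^-1 * f z| <= 1.
  move=> Dz; rewrite normrM gtr0_norm ?invr_gt0// mulrC ler_pdivrMr// mul1r.
  by rewrite le_max fM0// orbT.
have bsg : bp (fun z => Num.sg (f z)).
  apply: (@bp_lim _ (fun n z => iter n sgstep (M^-1 * f z)) 1).
  - elim=> [|n ih] /=; first exact: bp_scale.
    apply: (@bp_eq (fun z => (3 / 2) * iter n sgstep (M^-1 * f z) + (- 2^-1) *
      (iter n sgstep (M^-1 * f z) * (iter n sgstep (M^-1 * f z) *
      iter n sgstep (M^-1 * f z))))).
      by apply: bp_add; apply: bp_scale => //; do 2?[apply: bp_mul => //].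
    by move=> z _; rewrite /sgstep; field.
  - by move=> n z Dz; apply: iter_sgstep_bound; exact: fM.
  - move=> z Dz; rewrite (_ : Num.sg (f z) = Num.sg (M^-1 * f z)).
      exact: cvg_iter_sgstep (fM z Dz).
    by rewrite sgrM (@gtr0_sg _ M^-1) ?invr_gt0// mul1r.
apply: (@bp_eq (fun z => 2^-1 * (Num.sg (f z) + Num.sg (f z) * Num.sg (f z)))).
  by apply: bp_scale; apply: bp_add => //; exact: bp_mul.
move=> z _; rewrite indicE; case: (boolP (z \in _)); rewrite ?inE ?notin_setE/=.
  by move=> /gtr0_sg ->; rewrite mulr1n; field.
move=> /negP; rewrite -leNgt le_eqVlt => /predU1P[->|/ltr0_sg ->].
  by rewrite sgr0 !(mulr0,addr0).
by rewrite mulrNN mulr1 addNr mulr0.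
Qed.

(** Complements and intersections come from the algebra operations, countable
    unions from the pointwise limit of the finite ones. *)
Lemma sigma_algebra_bp_indic : sigma_algebra setT [set A | bp (\1_A)].
Proof.
have bpC A : bp (\1_A) -> bp (\1_(setT `\` A)).
  move=> bA; apply: (@bp_eq (fun z => 1 + (-1) * \1_A z)).
    by apply: bp_add; [exact: bp_cst|exact: bp_scale].
  by move=> z _; rewrite !indicE in_setD in_setT; case: (_ \in A) => /=; ring.
split => /=.
- by rewrite indic0; exact: bp_cst.
- exact: bpC.
- move=> A bA.
  have bU n : bp (\1_(\bigcup_(k < n) A k)).
    elim: n => [|n ih]; first by rewrite bigcup_mkord big_ord0 indic0; exact: bp_cst.
    apply: (@bp_eq (fun z => \1_(\bigcup_(k < n) A k) z + (\1_(A n) z +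
       (-1) * (\1_(\bigcup_(k < n) A k) z * \1_(A n) z)))).
      by do 2![apply: bp_add => //]; apply: bp_scale; exact: bp_mul.
    move=> z _; rewrite !bigcup_mkord big_ord_recr/= !indicE in_setU.
    by case: (z \in _); case: (z \in A n) => /=; ring.
  apply: (@bp_lim _ (fun n => \1_(\bigcup_(k < n) A k)) 1) => // [n z _|z _].
    by rewrite indicE; case: (_ \in _); rewrite ?normr1 ?normr0.
  apply: cvg_near_cst; have [[k _ Akz]|nA] := pselect ((\bigcup_k A k) z).
    exists k.+1 => // n /= kn; rewrite !indicE !mem_set//; first by exists k.
    by exists k.
  apply: nearW => n; rewrite !indicE !memNset// => -[k _ ?]; apply: nA.
  by exists k.
Qed.

Import HBNNSimple.

(** The functional monotone class theorem for an algebra [X]: as soon as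
    the sets of [G] have their indicators in the closure, so do all measurable
    sets, and bounded measurable functions are bounded limits of simple
    functions. *)
Lemma bp_measurable (G : set (set T)) (f : T -> R) : measurable D ->
  (@measurable _ T = <<s G >>) -> (forall A, G A -> bp (\1_A)) ->
  measurable_fun D f -> (exists M, forall z, D z -> `|f z| <= M) -> bp f.
Proof.
move=> mD mG GA mf [M fM].
have bA A : measurable A -> bp (\1_A).
  rewrite mG; have /(_ A) := smallest_sub sigma_algebra_bp_indic GA; exact.
(* Simple functions approximate nonnegative functions, hence the shift by M. *)
pose g z := f z + M.
have mg : measurable_fun D (EFin \o g).
  by apply/measurable_EFinP; apply: measurable_funD => //; exact: measurable_cst.
have g0 z : D z -> (0 <= (EFin \o g) z)%E.
  by move=> /fM; rewrite lee_fin /g ler_norml => /andP[? ?]; lra.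
apply: (@bp_eq (fun z => g z + (- M))); last by move=> z _; rewrite /g addrK.
apply: bp_add; last exact: bp_cst.
apply: (@bp_lim _ (fun n => nnsfun_approx mD mg n) (M + M)).
- move=> n; have /funext -> := fimfunEord (nnsfun_approx mD mg n).
  by apply: bp_sum => i; apply: bp_scale; apply: bA.
- move=> n z Dz; rewrite ger0_norm// -lee_fin nnsfun_approxE.
  apply: (@le_trans _ _ (g z)%:E); first exact: (@le_approx _ _ _ D (EFin \o g) n z).
  by rewrite lee_fin /g lerD2r (le_trans (ler_norm _))// fM.
- by move=> z Dz; have /fine_cvgP[_] := cvg_nnsfun_approx mD mg g0 Dz; exact.
Qed.

End bpclosure.

(** * The closure of the polynomials in the mean square *)
Section dominated_real.
Context d (T : measurableType d) (R : realType).
Variables (mu : {measure set T -> \bar R}) (D : set T) (mD : measurable D).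

Lemma dominated_cvg_real (F : nat -> T -> R) (f g : T -> R) :
  (forall n, measurable_fun D (F n)) ->
  (forall x, D x -> F n x @[n --> \oo] --> f x) ->
  mu.-integrable D (EFin \o g) ->
  (forall n x, D x -> `|F n x| <= g x) ->
  (\int[mu]_(x in D) (F n x)%:E)%E @[n --> \oo] --> (\int[mu]_(x in D) (f x)%:E)%E.
Proof.
move=> mF Ff ig Fg.
have mf : measurable_fun D f by exact: measurable_fun_cvg Ff.
have [] := @dominated_convergence _ _ _ mu D mD (fun n x => (F n x)%:E)
  (EFin \o f) (EFin \o g) => //.
- by move=> n; apply/measurable_EFinP.
- exact/measurable_EFinP.
- by apply/aeW => x Dx; apply: cvg_EFin; [exact: nearW|exact: Ff].
- by apply/aeW => x n Dx; rewrite lee_fin Fg.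
Qed.

Lemma near_lt_ereal (u : nat -> \bar R) (l a : \bar R) :
  u n @[n --> \oo] --> l -> (l < a)%E -> \forall n \near \oo, (u n < a)%E.
Proof.
move=> ul la; apply: (ul [set y | y < a]%E).
by apply: open_nbhs_nbhs; split => //; exact: open_ereal_lt_ereal.
Qed.

End dominated_real.

Section polynomial_closure.
Context {R : realType}.
Local Notation C := R[i].
Variables (mu : {measure set C -> \bar R}) (D : set C) (mD : measurable D).
Implicit Types f g : C -> C.

Definition sqint f : \bar R := (\int[mu]_(z in D) (sqn (f z))%:E)%E.

Lemma sqint_ge0 f : (0 <= sqint f)%E.
Proof. by apply: integral_ge0 => z _; rewrite lee_fin sqn_ge0. Qed.

Lemma eq_sqint f g : (forall z, D z -> sqn (f z) = sqn (g z)) -> sqint f = sqint g.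
Proof. by move=> fg; apply: eq_integral => z; rewrite inE => Dz; rewrite fg. Qed.

Lemma sqintD f g : measurable_fun D f -> measurable_fun D g ->
  (sqint (fun z => f z + g z)%R <= 2%:E * sqint f + 2%:E * sqint g)%E.
Proof.
move=> mf mg; rewrite /sqint.
have m h : measurable_fun D h -> measurable_fun D (fun z => (sqn (h z))%:E).
  by move=> mh; apply/measurable_EFinP; exact: measurable_sqn.
have p h z : (0 <= (sqn (h z))%:E :> \bar R)%E by rewrite lee_fin sqn_ge0.
rewrite -!ge0_integralZl_EFin//; try by [exact: m|move=> z _; exact: p].
have m2 h : measurable_fun D h -> measurable_fun D (fun z => 2%:E * (sqn (h z))%:E)%E.
  by move=> mh; apply: measurable_funeM; exact: m.
have p2 h z : (0 <= 2%:E * (sqn (h z))%:E :> \bar R)%E by rewrite mule_ge0// lee_fin.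
rewrite -ge0_integralD//; [|exact: m2|exact: m2].
apply: ge0_le_integral => //.
- by apply: m; exact: measurable_cD.
- by apply: emeasurable_funD; exact: m2.
- by move=> z _; rewrite -!EFinM -EFinD lee_fin sqnD.
Qed.

(** Membership in the closure of the polynomials in [L^2(D, mu)], measured with
    the squared norm so that the parallelogram bound [sqintD] replaces the
    triangle inequality. *)
Definition poly_approx f := measurable_fun D f /\
  forall e : R, 0 < e -> exists p : {poly C}, (sqint (fun z => f z - p.[z])%R < e%:E)%E.

Lemma poly_approx_poly (p : {poly C}) : poly_approx (fun z => p.[z]).
Proof.
split=> [|e e0]; first exact: measurable_horner.
exists p; rewrite /sqint integral0_eq ?lte_fin// => z _.
by rewrite subrr /sqn/= expr0n addr0.
Qed.

Lemma measurable_cN f : measurable_fun D f -> measurable_fun D (fun z => - f z).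
Proof.
move=> mf; under eq_fun do rewrite -mulN1r.
by apply: measurable_cM => //; exact: measurable_cst.
Qed.

Let sqint_lt f g h e : measurable_fun D f -> measurable_fun D g ->
  (forall z, D z -> h z = f z + g z) ->
  (sqint f < (e / 4)%:E)%E -> (sqint g < (e / 4)%:E)%E -> (sqint h < e%:E)%E.
Proof.
move=> mf mg hfg f4 g4; rewrite (@eq_sqint _ (fun z => f z + g z)); last first.
  by move=> z /hfg ->.
apply: (le_lt_trans (sqintD mf mg)).
have := sqint_ge0 f; have := sqint_ge0 g; move: f4 g4.
case: (sqint f) => // a; case: (sqint g) => // b; rewrite !lte_fin => *; lra.
Qed.

Lemma poly_approx_closed f : measurable_fun D f ->
  (forall e : R, 0 < e -> exists2 g, poly_approx g & (sqint (fun z => f z - g z)%R < e%:E)%E) ->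
  poly_approx f.
Proof.
move=> mf fg; split => // e e0.
have e4 : 0 < e / 4 by rewrite divr_gt0.
have [g [mg gp] fge] := fg _ e4; have [p gpe] := gp _ e4; exists p.
have mp := @measurable_horner R D p.
apply: (sqint_lt _ _ _ fge gpe) => [||z Dz]; last by rewrite addrA subrK.
- by apply: measurable_cD => //; exact: measurable_cN.
- by apply: measurable_cD => //; exact: measurable_cN.
Qed.

Lemma poly_approxD f g : poly_approx f -> poly_approx g ->
  poly_approx (fun z => f z + g z).
Proof.
move=> [mf fp] [mg gp]; split => [|e e0]; first exact: measurable_cD.
have e4 : 0 < e / 4 by rewrite divr_gt0.
have [p pe] := fp _ e4; have [q qe] := gp _ e4; exists (p + q).
have mp := @measurable_horner R D p; have mq := @measurable_horner R D q.
apply: (sqint_lt _ _ _ pe qe) => [||z Dz]; last by rewrite hornerD opprD addrACA.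
- by apply: measurable_cD => //; exact: measurable_cN.
- by apply: measurable_cD => //; exact: measurable_cN.
Qed.

(** Multiplication by a function [m] of modulus at most 1 is a contraction of
    [L^2], so that it is enough to know where it sends the polynomials. *)
Lemma poly_approxM (m f : C -> C) : measurable_fun D m ->
  (forall z, D z -> sqn (m z) <= 1) ->
  (forall p : {poly C}, poly_approx (fun z => m z * p.[z])) ->
  poly_approx f -> poly_approx (fun z => m z * f z).
Proof.
move=> mm m1 mp [mf fp]; apply: poly_approx_closed; first exact: measurable_cM.
move=> e /fp[p pe]; exists (fun z => m z * p.[z]) => //.
apply: le_lt_trans pe; apply: ge0_le_integral => //.
- by move=> z _; rewrite lee_fin sqn_ge0.
- apply/measurable_EFinP/measurable_sqn/measurable_cD; first exact: measurable_cM.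
  by apply: measurable_cN; exact: (mp p).1.
- apply/measurable_EFinP/measurable_sqn/measurable_cD => //.
  by apply: measurable_cN; exact: measurable_horner.
- move=> z Dz; rewrite lee_fin -mulrBr sqnM ler_piMl ?sqn_ge0//; exact: m1.
Qed.

Lemma poly_approxZ c f : poly_approx f -> poly_approx (fun z => c * f z).
Proof.
move=> [mf fp]; split => [|e e0].
  by apply: measurable_cM => //; exact: measurable_cst.
have c1 : 0 < sqn c + 1 by rewrite ltr_wpDl// sqn_ge0.
have [p pe] := fp (e / (sqn c + 1)) (divr_gt0 e0 c1); exists (c *: p).
rewrite (_ : sqint _ = ((sqn c)%:E * sqint (fun z => f z - p.[z])%R)%E); last first.
  rewrite /sqint -ge0_integralZl_EFin ?sqn_ge0//.
  - by apply: eq_integral => z _; rewrite hornerZ -mulrBr sqnM.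
  - by move=> z _; rewrite lee_fin sqn_ge0.
  - apply/measurable_EFinP/measurable_sqn/measurable_cD => //.
    by apply: measurable_cN; exact: measurable_horner.
have := sqint_ge0 (fun z => f z - p.[z]); move: pe.
case: (sqint _) => // a; rewrite lte_fin lee_fin ltr_pdivlMr// -EFinM lte_fin => h a0.
by have := sqn_ge0 c; nra.
Qed.

Lemma poly_approx_eq f g : measurable_fun D g -> (forall z, D z -> g z = f z) ->
  poly_approx f -> poly_approx g.
Proof.
move=> mg gf fp; apply: poly_approx_closed => // e e0; exists f => //.
rewrite /sqint integral0_eq ?lte_fin// => z Dz.
by rewrite gf// subrr /sqn/= expr0n addr0.
Qed.

End polynomial_closure.

(** * The unit circle: functions, limits and density *)
Section circle.
Context {R : realType}.
Local Notation C := R[i].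
Local Notation S1 := (@unit_circle R).

Lemma unit_circleE (z : C) : S1 z <-> sqn z = 1.
Proof.
rewrite /unit_circle /= normcEr -normc_sqr; split => [/eqP|/eqP].
  by rewrite eq_complex /= eqxx andbT => /eqP ->; rewrite expr1n.
by rewrite -[X in _ == X](expr1n _ 2) eqrXn2 ?normc_ge0// => /eqP ->.
Qed.

Lemma sqn_circle (z : C) : S1 z -> sqn z = 1. Proof. by move/unit_circleE. Qed.

Lemma measurable_unit_circle : measurable S1.
Proof.
rewrite (_ : S1 = [set: C] `&` (fun z => sqn z) @^-1` [set 1]).
  by apply: (measurable_sqn (f := id)) => //; exact: measurable_id.
by apply/seteqP; split => z /=; [move/unit_circleE|move=> [_ ?]; exact/unit_circleE].
Qed.

Lemma circle_conj (z : C) : S1 z -> z * (z^*)%C = 1.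
Proof.
move/unit_circleE; case: z => a b; rewrite /sqn/= => ab.
by apply/eqP; rewrite eq_complex /=; apply/andP; split; apply/eqP; [rewrite -ab|]; ring.
Qed.

Lemma Re_conj (z : C) : Re (z^*)%C = Re z. Proof. by case: z. Qed.
Lemma Im_conj (z : C) : Im (z^*)%C = - Im z. Proof. by case: z. Qed.

Lemma sqnJ (z : C) : sqn (z^*)%C = sqn z.
Proof. by rewrite /sqn Re_conj Im_conj sqrrN. Qed.

Lemma measurable_conj d (T : measurableType d) (D : set T) (f : T -> C) :
  measurable_fun D f -> measurable_fun D (fun x => (f x)^*%C).
Proof.
move=> mf; apply: measurable_ReIm.
  by under eq_fun do rewrite Re_conj; exact: measurable_Re.
by under eq_fun do rewrite Im_conj; apply: measurableT_comp => //; exact: measurable_Im.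
Qed.

(** On the circle [conj z] is [1 / z], so the real parts of polynomials are all
    the real trigonometric polynomials. *)
Definition trig : set (C -> R) := [set f | exists p : {poly C}, f = fun z => Re p.[z]].

Lemma normc_circle (z : C) : S1 z -> normc z = 1.
Proof. by move=> /eqP; rewrite normcEr eq_complex/= eqxx andbT => /eqP. Qed.

Lemma poly_bounded (p : {poly C}) : exists M, forall z, S1 z -> normc p.[z] <= M.
Proof.
elim/poly_ind: p => [|p c [M pM]].
  by exists 0 => z _; rewrite horner0 normc0.
exists (M + normc c) => z Sz; rewrite !hornerE (le_trans (le_normcD _ _))// lerD2r.
by rewrite normcM (normc_circle Sz) mulr1 pM.
Qed.

Lemma poly_sqn_bounded (p : {poly C}) : exists M, forall z, S1 z -> sqn p.[z] <= M.
Proof.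
have [M pM] := poly_bounded p; exists (M ^+ 2) => z Sz.
have M0 : 0 <= M := le_trans (normc_ge0 _) (pM z Sz).
by rewrite -normc_sqr; apply: lerXn2r; rewrite ?nnegrE ?normc_ge0 ?pM.
Qed.

Lemma trig_bounded f : trig f -> exists M, forall z, S1 z -> `|f z| <= M.
Proof.
move=> [p ->]; have [M pM] := poly_bounded p; exists M => z Sz.
exact: le_trans (Re_le_normc _) (pM z Sz).
Qed.

Lemma trig_cst c : trig (cst c).
Proof. by exists (c%:C%C)%:P; apply/funext => z; rewrite hornerC. Qed.

Lemma trig_add f g : trig f -> trig g ->
  exists2 h, trig h & forall z, S1 z -> h z = f z + g z.
Proof.
move=> [p ->] [q ->]; exists (fun z => Re (p + q).[z]); first by exists (p + q).
by move=> z _; rewrite hornerD Re_add.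
Qed.

(** On the circle [z * conj z = 1] cancels one power of [z] in a product
    [p * conj q] of polynomials, which yields a recursion on both degrees; the
    terms that remain conjugated are replaced by their conjugates, which have
    the same real part. *)
Lemma trig_conj_mul (p q : {poly C}) : exists s : {poly C},
  forall z, S1 z -> Re (p.[z] * (q.[z])^*%C) = Re s.[z].
Proof.
elim/poly_ind: p q => [|p c ih] q.
  by exists 0 => z _; rewrite !horner0 mul0r.
elim/poly_ind: q => [|q a _].
  by exists 0 => z _; rewrite !horner0 conjc0 mulr0.
have [s hs] := ih q.
exists (s + (a^*)%C *: (p * 'X) + (c^*)%C *: (q * 'X) + (c * a^*%C)%:P) => z Sz.
rewrite !hornerE !Re_add -hs// !rmorphD !rmorphM/=.
have zz : sqn z = 1 by exact: sqn_circle.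
move: (p.[z]) (q.[z]) zz => [p1 p2] [q1 q2]; rewrite /sqn.
case: z {Sz} => z1 z2 /= zz; case: a => a1 a2; case: c => c1 c2 /=.
have -> : (p1 * q1 - p2 * - q2) = (p1 * q1 - p2 * - q2) * (z1 ^+ 2 + z2 ^+ 2).
  by rewrite zz mulr1.
by ring.
Qed.

(** [2 Re p Re q = Re (p conj q) + Re (p q)]. *)
Lemma trig_mul f g : trig f -> trig g ->
  exists2 h, trig h & forall z, S1 z -> h z = f z * g z.
Proof.
move=> [p ->] [q ->]; have [s hs] := trig_conj_mul p q.
pose h := (2^-1)%:C%C *: (s + p * q).
exists (fun z => Re h.[z]); first by exists h.
move=> z Sz; have := hs _ Sz; rewrite !hornerE !Re_mul !Re_add Re_conj Im_conj /= => <-.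
by rewrite Re_mul; field.
Qed.

(** The coordinates [Re z] and [Im z = Re (- i z)] are trigonometric, and the
    half-planes that they define generate the Borel sets. *)
Lemma bp_trig_measurable (f : C -> R) : measurable_fun S1 f ->
  (exists M, forall z, S1 z -> `|f z| <= M) -> bpclosure S1 trig f.
Proof.
apply: (bp_measurable trig_bounded trig_cst trig_add trig_mul
  measurable_unit_circle borel_half_planes).
have bRe : bpclosure S1 trig (fun z => Re z).
  by apply: bp_sub; exists 'X; apply/funext => z; rewrite hornerX.
have bIm : bpclosure S1 trig (fun z => Im z).
  apply: bp_sub; exists ((- 'i%C) *: 'X); apply/funext => z.
  by rewrite !hornerE; case: z => a b /=; ring.
have bpS c g : bpclosure S1 trig g -> bpclosure S1 trig (fun z => c * g z).
  exact: (bp_scale trig_bounded trig_cst trig_mul).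
have bpA c g : bpclosure S1 trig g -> bpclosure S1 trig (fun z => g z + c).
  move=> bg; apply: (bp_add trig_bounded trig_add) => //.
  exact: (bp_cst _ trig_cst).
have gt0 := bp_indic_gt0 trig_bounded trig_cst trig_add trig_mul.
have gt (g : C -> R) a : bpclosure S1 trig g -> bpclosure S1 trig \1_[set z | a < g z].
  move=> bg; rewrite (_ : [set z | a < g z] = [set z | 0 < g z - a]).
    by apply: gt0; exact: bpA.
  by apply/seteqP; split => z /=; rewrite subr_gt0.
have lt (g : C -> R) a : bpclosure S1 trig g -> bpclosure S1 trig \1_[set z | g z < a].
  move=> bg; rewrite (_ : [set z | g z < a] = [set z | 0 < (-1) * g z + a]).
    by apply: gt0; apply: bpA; exact: bpS.
  by apply/seteqP; split => z /=; rewrite mulN1r addrC subr_gt0.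
by move=> _ [a [|[|[|]]] ->]; [exact: gt|exact: lt|exact: gt|exact: lt].
Qed.

(** Once [conj z] is a limit of polynomials, the closure of the polynomials is
    stable under multiplication by [conj z], hence contains the conjugates of
    the polynomials and the trigonometric polynomials. *)
Section density.
Variable mu : {finite_measure set C -> \bar R}.
Hypothesis conj_approx : poly_approx mu S1 (fun z => (z^*)%C).
Let mS1 := measurable_unit_circle.
Local Notation approx := (poly_approx mu S1).

Let approx_conjM f : approx f -> approx (fun z => (z^*)%C * f z).
Proof.
have mz : measurable_fun S1 (fun z : C => (z^*)%C).
  by apply: measurable_conj; exact: measurable_id.
apply: poly_approxM => // [z Sz|p]; first by rewrite sqnJ sqn_circle.
elim/poly_ind: p => [|p c _].
  apply: (@poly_approx_eq _ _ _ mS1 (fun z => (0 : {poly C}).[z])).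
  - by apply: measurable_cM => //; exact: measurable_horner.
  - by move=> z _; rewrite horner0 mulr0.
  - exact: poly_approx_poly.
apply: (@poly_approx_eq _ _ _ mS1 (fun z => p.[z] + c * (z^*)%C)).
- by apply: measurable_cM => //; exact: measurable_horner.
- move=> z Sz; rewrite !hornerE mulrDr mulrCA mulrC.
  by rewrite [_ * z]mulrC circle_conj// mul1r [c * _]mulrC.
- apply: poly_approxD => //; first exact: poly_approx_poly.
  exact: poly_approxZ.
Qed.

Let approx_conj_poly (p : {poly C}) : approx (fun z => (p.[z])^*%C).
Proof.
elim/poly_ind: p => [|p c ih].
  apply: (@poly_approx_eq _ _ _ mS1 (fun z => (0 : {poly C}).[z])).
  - by apply: measurable_conj; exact: measurable_horner.
  - by move=> z _; rewrite !horner0 conjc0.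
  - exact: poly_approx_poly.
apply: (@poly_approx_eq _ _ _ mS1 (fun z => (z^*)%C * (p.[z])^*%C + (c^*%C)%:P.[z])).
- by apply: measurable_conj; exact: measurable_horner.
- by move=> z _; rewrite !hornerE rmorphD rmorphM mulrC.
- apply: poly_approxD => //; first exact: approx_conjM.
  exact: poly_approx_poly.
Qed.

Let measurable_realc (f : C -> R) : measurable_fun S1 f ->
  measurable_fun S1 (fun z => (f z)%:C%C).
Proof. by move=> mf; apply: measurable_ReIm => //; exact: measurable_cst. Qed.

Let approx_trig f : trig f -> approx (fun z => (f z)%:C%C).
Proof.
move=> [p ->].
apply: (@poly_approx_eq _ _ _ mS1
  (fun z => (2^-1)%:C%C * (p.[z] + (p.[z])^*%C))).
- apply: measurable_realc; apply: measurable_Re; exact: measurable_horner.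
- move=> z _; case: p.[z] => a b; apply/eqP; rewrite eq_complex /=.
  by apply/andP; split; apply/eqP; field.
- apply: poly_approxZ => //; apply: poly_approxD => //.
  exact: poly_approx_poly.
Qed.

Let approx_bp f : bpclosure S1 trig f ->
  measurable_fun S1 f /\ approx (fun z => (f z)%:C%C).
Proof.
elim=> {f} [f tf|F M f bF ih FM Ff].
  split; last exact: approx_trig.
  by case: tf => p ->; apply: measurable_Re; exact: measurable_horner.
have mf : measurable_fun S1 f by apply: measurable_fun_cvg Ff => n; exact: (ih n).1.
split => //; apply: poly_approx_closed => //; first exact: measurable_realc.
move=> e e0.
have fM z : S1 z -> `|f z| <= M.
  move=> Sz; apply: (cvgr_to_le (cvg_norm (Ff z Sz))).
  by apply: nearW => n; exact: FM.
have : (\int[mu]_(z in S1) ((f z - F n z) ^+ 2)%:E)%E @[n --> \oo] -->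
    (\int[mu]_(z in S1) ((fun=> 0) z)%:E)%E.
  apply: (@dominated_cvg_real _ _ _ mu S1 mS1 _ _ (cst ((M + M) ^+ 2))) => //.
  - by move=> n; apply: measurable_funX; apply: measurable_funB => //; exact: (ih n).1.
  - move=> z Sz; rewrite [X in _ --> X](_ : 0 = (f z - f z) * (f z - f z)); last first.
      by rewrite subrr mul0r.
    under eq_fun do rewrite expr2.
    by apply: cvgM; apply: cvgB => //; (exact: cvg_cst || exact: Ff).
  - exact: finite_measure_integrable_cst.
  - move=> n z Sz; have M0 : 0 <= M := le_trans (normr_ge0 _) (fM _ Sz).
    rewrite normrX; apply: lerXn2r; rewrite ?nnegrE ?addr_ge0//.
    by rewrite (le_trans (ler_normB _ _))// lerD ?fM ?FM.
have e0' : (0 < e%:E :> \bar R)%E by rewrite lte_fin.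
rewrite integral0 => /near_lt_ereal /(_ e0')[N _ /(_ N (leqnn N)) h]; exists (fun z => (F N z)%:C%C); first exact: (ih N).2.
apply: le_lt_trans h; rewrite le_eqVlt; apply/predU1P; left.
by apply: eq_integral => z _; rewrite -rmorphB sqn_real.
Qed.

Lemma approx_bounded f : measurable_fun S1 f ->
  (exists M, forall z, S1 z -> sqn (f z) <= M) -> approx f.
Proof.
move=> mf [M fM].
have sq_le (x : R) : x ^+ 2 <= M -> `|x| <= M + 1.
  rewrite -(real_normK (num_real x)); have := normr_ge0 x; nra.
have aR : approx (fun z => (Re (f z))%:C%C).
  apply: (approx_bp _).2; apply: bp_trig_measurable; first exact: measurable_Re.
  exists (M + 1) => z /fM h; apply/sq_le/(le_trans _ h); rewrite lerDl; exact: sqr_ge0.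
have aI : approx (fun z => (Im (f z))%:C%C).
  apply: (approx_bp _).2; apply: bp_trig_measurable; first exact: measurable_Im.
  exists (M + 1) => z /fM h; apply/sq_le/(le_trans _ h); rewrite lerDr; exact: sqr_ge0.
apply: (@poly_approx_eq _ _ _ mS1
  (fun z => (Re (f z))%:C%C + 'i%C * (Im (f z))%:C%C)) => //.
  by move=> z _; exact: complexE.
by apply: poly_approxD => //; exact: poly_approxZ.
Qed.

(** An [L^2] function is the limit of its restrictions to the sets
    [|f|^2 < n]. *)
Lemma approx_L2 f : measurable_fun S1 f -> (sqint mu S1 f < +oo)%E -> approx f.
Proof.
move=> mf fi.
pose b n z : R := \1_[set x | sqn (f x) < n%:R] z.
have mb n : measurable_fun S1 (b n).
  apply: (@eq_measurable_fun _ _ _ _ S1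
    (fun z => if sqn (f z) < n%:R then 1 else 0 : R)).
    move=> z _; rewrite /b indicE; case: ifPn => h; first by rewrite mem_set.
    by rewrite memNset//; apply/negP.
  apply: measurable_fun_if => //.
  by apply: measurable_fun_ltr => //; exact: measurable_sqn.
have mbf n : measurable_fun S1 (fun z => (b n z)%:C%C * f z).
  by apply: measurable_cM => //; exact: measurable_realc.
apply: poly_approx_closed => // e e0.
have : (\int[mu]_(z in S1) (sqn (f z - (b n z)%:C%C * f z))%:E)%E @[n --> \oo] -->
    (\int[mu]_(z in S1) ((fun=> 0) z)%:E)%E.
  apply: (@dominated_cvg_real _ _ _ mu S1 mS1 _ _ (fun z => sqn (f z))) => //.
  - move=> n; apply: measurable_sqn; apply: measurable_cD => //.
    exact: measurable_cN.
  - move=> z Sz; apply: cvg_near_cst.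
    exists (Num.truncn (sqn (f z))).+1 => // n /= hn.
    rewrite /b indicE mem_set/=; first by rewrite mul1r subrr /sqn/= expr0n addr0.
    by rewrite (lt_le_trans (truncnS_gt _))// ler_nat.
  - apply/integrableP; split; first exact/measurable_EFinP/measurable_sqn.
    under eq_integral => z _ do rewrite /= ger0_norm ?sqn_ge0//.
    exact: fi.
  - move=> n z Sz; rewrite ger0_norm ?sqn_ge0// /b indicE.
    case: (_ \in _); rewrite /= ?mul1r ?mul0r ?subr0// subrr /sqn /= expr0n addr0.
    exact: sqn_ge0.
have e0' : (0 < e%:E :> \bar R)%E by rewrite lte_fin.
rewrite integral0 => /near_lt_ereal /(_ e0')[N _ /(_ N (leqnn N)) h]; exists (fun z => (b N z)%:C%C * f z) => //.
apply: approx_bounded => //; exists N%:R => z Sz.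
rewrite sqnM sqn_real /b indicE; case: (boolP (_ \in _)); rewrite ?inE/=.
  by rewrite expr1n mul1r => /ltW.
by rewrite expr0n mul0r.
Qed.

End density.
End circle.

(** * The mean value over the circle *)
Section mean_value.
Context {R : realType}.
Local Notation C := R[i].
Local Notation S1 := (@unit_circle R).

Lemma expi_circle (t : R) : S1 (expi t).
Proof. by apply/unit_circleE; rewrite /sqn/= cos2Dsin2. Qed.

Lemma expiX (t : R) n : expi t ^+ n = expi (n%:R * t).
Proof.
elim: n => [|n ih]; first by rewrite expr0 mul0r /expi cos0 sin0.
rewrite exprS ih -natr1 mulrDl mul1r addrC /expi cosD sinD.
by apply/eqP; rewrite eq_complex /=; apply/andP; split; apply/eqP; ring.
Qed.

Lemma expi_2pi (n : nat) : expi (n%:R * (2 * pi)) = 1 :> C.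
Proof.
rewrite -expiX /expi.
by rewrite mulr_natl cos2pi sin2pi expr1n.
Qed.

Lemma measurable_comp_expi d (T : measurableType d) (f : C -> T) :
  measurable_fun S1 f -> measurable_fun [set: measurableTypeR R] (f \o expi).
Proof.
move=> mf; apply: (measurable_comp measurable_unit_circle) => //.
- by move=> _ [t _ <-]; exact: expi_circle.
- exact: measurable_expi.
Qed.

Let ge0_integral_arc (f : C -> \bar R) : measurable_fun S1 f ->
  (forall z, S1 z -> (0 <= f z)%E) ->
  (\int[arc_length]_(z in S1) f z =
   \int[lebesgue_measure]_(t in `[0%R, (2 * pi)%R[) f (expi t))%E.
Proof.
move=> mf f0.
have mexpi := @measurable_expi R.
pose I := measurable_itv `[(0 : R), 2 * pi[.
pose leb := mrestr (lebesgue_measure : {measure set (measurableTypeR R) -> \bar R}) I.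
transitivity (\int[pushforward leb expi]_(z in S1) f z)%E.
  exact: eq_measure_integral.
rewrite ge0_integral_pushforward//; last 2 first.
  - exact: measurable_unit_circle.
  - by move=> z; rewrite inE; exact: f0.
rewrite (_ : expi @^-1` S1 = setT); last first.
  by apply/seteqP; split => t // _; exact: expi_circle.
have mfe : measurable_fun [set: measurableTypeR R] (f \o expi).
  exact: measurable_comp_expi.
rewrite (@ge0_negligible_integral _ _ _ leb setT (~` `[0, 2 * pi[))//; last 3 first.
  - exact: measurableC.
  - by move=> t _; apply: f0; exact: expi_circle.
  - by rewrite /leb /= /mrestr setICl measure0.
rewrite setTD setCK; apply: eq_measure_integral => A mA AI.
by rewrite /leb /= /mrestr setIidl.
Qed.

(** No integrability is assumed: the positive and negative parts are
    transported separately. This matters for functions whose integral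
    is infinite. *)
Lemma integral_arc (f : C -> \bar R) : measurable_fun S1 f ->
  (\int[arc_length]_(z in S1) f z =
   \int[lebesgue_measure]_(t in `[0%R, (2 * pi)%R]) f (expi t))%E.
Proof.
move=> mf.
rewrite -integral_itv_bndo_bndc; last first.
  apply: (measurable_funS (E := setT)) => //.
  exact: (measurable_comp_expi mf).
rewrite integralE [RHS]integralE !ge0_integral_arc//.
- by congr (_ - _)%E; apply: eq_integral => t _; rewrite unlock.
- exact: measurable_funeneg.
- exact: measurable_funepos.
Qed.

(* t |-> Re (p (e^(it))) has the antiderivative
   Re p(0) t + sum_(k > 0) Im (p_k e^(ikt)) / k, whose sum is 2 pi-periodic. *)
Let antiderivative_spec (p : {poly C}) (F : R -> R) :=
  (forall t : R, is_derive t (1 : R) F (Re p.[expi t])) /\ F (2 * pi) - F 0 = 2 * pi * Re p.[0].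

Let antiderivative (p : {poly C}) : exists F, antiderivative_spec p F.
Proof.
rewrite -(coefK p) poly_def.
elim/big_ind: _ => [|p1 p2 [F1 [d1 e1]] [F2 [d2 e2]]|i _].
- exists (cst 0); split => [t|]; first by rewrite horner0; exact: is_derive_cst.
  by rewrite horner0 /= subrr mulr0.
- exists (F1 \+ F2); split => [t|].
    by rewrite hornerD Re_add; exact: is_deriveD.
  by rewrite hornerD Re_add [RHS]mulrDr -[X in _ = X + _]e1 -[X in _ = _ + X]e2 /=; ring.
- case: (nat_of_ord i) => [|k].
    exists (fun t => Re p`_0 * t); split => [t|].
      rewrite !hornerE ?mulr1.
      rewrite -[X in is_derive _ _ _ X]mulr1.
      exact: is_deriveZ.
    by rewrite !hornerE ?mulr1 /= subr0; ring.
  have k0 : k.+1%:R != 0 :> R by rewrite pnatr_eq0.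
  exists (fun t => k.+1%:R^-1 * Im (p`_k.+1 * expi (k.+1%:R * t))); split => [t|].
    rewrite !hornerE expiX.
    case: p`_k.+1 => a b /=.
    have dk : is_derive t (1 : R) ( *%R (k.+1%:R : R)) k.+1%:R.
      rewrite -[X in is_derive _ _ _ X]mulr1; exact: is_deriveZ.
    have ds := is_derive1_comp (is_derive_sin (k.+1%:R * t)) dk.
    have dc := is_derive1_comp (is_derive_cos (k.+1%:R * t)) dk.
    have := is_deriveZ k.+1%:R^-1 (is_deriveD (is_deriveZ a ds) (is_deriveZ b dc)).
    move=> h; apply: (is_derive_eq h).
    by rewrite /GRing.scale/=; field.
  rewrite expi_2pi !hornerE expr0n /= mulr0 mulr0 /expi cos0 sin0.
  by case: p`_k.+1 => a b /=; ring.
Qed.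

Definition circle_mean (L : C -> R) : R :=
  (2 * pi)^-1 * (\int[arc_length]_(z in S1) L z)%R.

Lemma circle_mean_Re_poly (p : {poly C}) :
  circle_mean (fun z => Re p.[z]) = Re p.[0].
Proof.
have [F [dF FE]] := antiderivative p.
have pi20 : 0 < 2 * pi :> R by rewrite mulr_gt0// pi_gt0.
rewrite /circle_mean /Rintegral integral_arc; last first.
  by apply/measurable_EFinP/measurable_Re; exact: measurable_horner.
rewrite (@continuous_FTC2 _ (fun t => Re p.[expi t]) F)//.
- by rewrite -EFinB/= FE mulrA mulVf ?mul1r// gt_eqF.
- apply: continuous_subspaceT => t.
  apply: (@continuous_comp _ _ _ (fun u => p.[expi u]) (fun w => Re w) t); last exact: Re_continuous.
  apply: (@continuous_comp _ _ _ expi (fun w => p.[w]) t); first exact: expi_continuous.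
  exact: horner_continuous.
- split.
  + by move=> t _; exact: ex_derive.
  + apply: cvg_at_right_filter; apply: differentiable_continuous.
    by apply/derivable1_diffP; exact: ex_derive.
  + apply: cvg_at_left_filter; apply: differentiable_continuous.
    by apply/derivable1_diffP; exact: ex_derive.
- by move=> t _; rewrite derive1E; exact: derive_val.
Qed.

End mean_value.

(** * A lower bound for the distance from the conjugate to the polynomials *)
Section compound_interest.
Context {R : realType}.

(** [1 / (1 + v) = 1 - v / (1 + v) <= exp (- v / (1 + v))]. *)
Lemma expR_le_add1 (v : R) : 0 < 1 + v -> expR (v / (1 + v)) <= 1 + v.
Proof.
move=> v1; rewrite -[leRHS]invrK -[leLHS]invrK lef_pV2 ?posrE ?invr_gt0 ?expR_gt0//.
rewrite -expRN (le_trans _ (expR_ge1Dx _))// le_eqVlt; apply/predU1P; left.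
by field; rewrite gt_eqF.
Qed.

(** The compound interest limit with a varying rate, squeezed between
    [exp (x_n / (1 + x_n / (n + 1)))] and [exp x_n]. *)
Lemma cvg_compound (x : nat -> R) (l : R) : x n @[n --> \oo] --> l ->
  (forall n, 0 <= 1 + x n / n.+1%:R) ->
  (1 + x n / n.+1%:R) ^+ n.+1 @[n --> \oo] --> expR l.
Proof.
move=> xl x0; pose u n := x n / n.+1%:R.
have u0 : u n @[n --> \oo] --> (0 : R).
  rewrite -[X in _ --> X](mulr0 l); apply: cvgM => //; exact: cvg_harmonic.
have n0 n : n.+1%:R != 0 :> R by rewrite pnatr_eq0.
have u1 : \forall n \near \oo, -1 < u n.
  by apply: (cvgr_gt _ u0); rewrite oppr_lt0.
apply: (@squeeze_cvgr _ _ _ _ (fun n => expR (x n / (1 + u n))) (fun n => expR (x n))).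
- near=> n.
  have un : 0 < 1 + u n by rewrite -ltrBlDl sub0r; near: n.
  apply/andP; split; last first.
    rewrite -[X in expR X](divfK (n0 n)) -/(u n) expRM_natr.
    by apply: lerXn2r; rewrite ?nnegrE ?expR_ge0 ?expR_ge1Dx ?(ltW un)//.
  rewrite (_ : x n / (1 + u n) = (u n / (1 + u n)) * n.+1%:R); last first.
    by rewrite -[in LHS](divfK (n0 n) (x n)) mulrAC.
  rewrite expRM_natr; apply: lerXn2r; rewrite ?nnegrE ?expR_ge0 ?(ltW un)//.
  exact: expR_le_add1.
- apply: continuous_cvg; first exact: continuous_expR.
  rewrite -[X in _ --> X]divr1; apply: cvgM => //.
  apply: cvgV; first exact: oner_neq0.
  by rewrite -[X in _ --> X]addr0; apply: cvgD => //; exact: cvg_cst.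
- by apply: continuous_cvg => //; exact: continuous_expR.
Unshelve. all: by end_near. Qed.

End compound_interest.

Section dominated_Rintegral.
Context d (T : measurableType d) (R : realType).
Variables (mu : {measure set T -> \bar R}) (D : set T) (mD : measurable D).

Lemma dominated_cvg_Rintegral (F : nat -> T -> R) (f g : T -> R) :
  (forall n, measurable_fun D (F n)) ->
  (forall x, D x -> F n x @[n --> \oo] --> f x) ->
  mu.-integrable D (EFin \o g) ->
  (forall n x, D x -> `|F n x| <= g x) ->
  \int[mu]_(x in D) F n x @[n --> \oo] --> \int[mu]_(x in D) f x.
Proof.
move=> mF Ff ig Fg.
have mf : measurable_fun D f by exact: measurable_fun_cvg Ff.
have fi : mu.-integrable D (EFin \o f).
  apply: le_integrable ig => //; first exact/measurable_EFinP.
  move=> x Dx; rewrite /= lee_fin [leRHS]ger0_norm; last first.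
    exact: le_trans (normr_ge0 _) (Fg 0%N _ Dx).
  by apply: (cvgr_to_le (cvg_norm (Ff x Dx))); apply: nearW => n; exact: Fg.
have := @dominated_cvg_real _ _ _ mu D mD F f g mF Ff ig Fg.
move=> h; apply: fine_cvg; rewrite fineK//; exact: integrable_fin_num.
Qed.

Lemma bounded_integrable (f : T -> R) (M : R) :
  (mu D < +oo)%E -> measurable_fun D f -> (forall x, D x -> `|f x| <= M) ->
  mu.-integrable D (EFin \o f).
Proof.
move=> muD mf fM; apply: measurable_bounded_integrable => //.
exists M; split; first exact: num_real.
by move=> y My x Dx; apply: le_trans (fM _ Dx) (ltW My).
Qed.

End dominated_Rintegral.

Section lower_bound.
Context {R : realType}.
Local Notation C := R[i].
Local Notation S1 := (@unit_circle R).
Variables (mu : {finite_measure set C -> \bar R}) (e : R).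
Hypothesis e_le : forall q : {poly C},
  (e%:E <= sqint mu S1 (fun z => 1 - z * q.[z])%R)%E.
Let mS1 := @measurable_unit_circle R.

Let muS1 : (mu S1 < +oo)%E.
Proof. by rewrite ltey_eq fin_num_measure. Qed.

(* Any P with P(0) = 1 has the form 1 - z q. *)
Let e_le_poly (P : {poly C}) : P.[0] = 1 ->
  e <= \int[mu]_(z in S1) sqn P.[z].
Proof.
move=> P0; have : root (P - 1) 0 by rewrite rootE !hornerE P0 subrr.
move=> /factor_theorem[q qE].
have PE z : P.[z] = 1 - z * (- q).[z].
  by rewrite -[P](subrK 1) qE !hornerE; ring.
have [M PM] := poly_sqn_bounded P.
have hM z : S1 z -> `|sqn P.[z]| <= M by move=> Sz; rewrite ger0_norm ?sqn_ge0 ?PM.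
have mP : measurable_fun S1 (fun z => sqn P.[z]).
  by apply: measurable_sqn; exact: measurable_horner.
have := bounded_integrable mS1 muS1 mP hM.
move=> /(integrable_fin_num mS1) fP.
rewrite -lee_fin /Rintegral fineK//; apply: (le_trans (e_le (- q))).
by rewrite le_eqVlt; apply/predU1P; left; apply: eq_sqint => z _; rewrite PE.
Qed.

(** For [L = log |P|^2] with [P(0) = 1] and no zero in the closed disc the mean
    of [L] is 0 and this is the bound of [e] by [int |P|^2 dmu]. *)
Definition mean_bound (L : C -> R) :=
  e * expR (circle_mean L) <= \int[mu]_(z in S1) expR (L z).

Let mean_bound_trig L : trig L -> mean_bound L.
Proof.
move=> [p ->]; rewrite /mean_bound circle_mean_Re_poly.
(* exp (h) would be the function of modulus squared exp (Re p - Re p(0)) with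
   value 1 at 0; the P n are polynomials that replace it. *)
pose h := (2^-1)%:C%C *: (p - (p.[0])%:P).
have h0 : h.[0] = 0 by rewrite hornerZ !hornerE subrr mulr0.
have [M1 h1] : exists M, forall z, S1 z -> `|Re h.[z]| <= M.
  by apply: trig_bounded; exists h.
have [M2 h2] := poly_sqn_bounded h.
pose x n z := 2 * Re h.[z] + sqn h.[z] / n.+1%:R.
pose P n := (1 + (n.+1%:R^-1)%:C%C *: h) ^+ n.+1.
have n0 n : n.+1%:R != 0 :> R by rewrite pnatr_eq0.
have baseE n z : sqn (1 + (n.+1%:R^-1)%:C%C * h.[z]) = 1 + x n z / n.+1%:R.
  by rewrite /x /sqn; case: h.[z] => a b /=; field; rewrite addrC natr1.
have PE n z : sqn (P n).[z] = (1 + x n z / n.+1%:R) ^+ n.+1.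
  by rewrite /P horner_exp sqnX hornerD hornerZ -baseE hornerE.
have base0 n z : 0 <= 1 + x n z / n.+1%:R by rewrite -baseE sqn_ge0.
have lim : \int[mu]_(z in S1) sqn (P n).[z] @[n --> \oo] -->
    \int[mu]_(z in S1) expR (2 * Re h.[z]).
  apply: (@dominated_cvg_Rintegral _ _ _ mu S1 mS1 _ _
    (cst (expR (2 * M1 + M2)))).
  - by move=> n; apply: measurable_sqn; exact: measurable_horner.
  - move=> z Sz; under eq_fun do rewrite PE.
    apply: (@cvg_compound _ (x ^~ z)) => //.
    rewrite -[X in _ --> X]addr0; apply: cvgD; first exact: cvg_cst.
    rewrite -[X in _ --> X](mulr0 (sqn h.[z])).
    by apply: cvgM; [exact: cvg_cst|exact: cvg_harmonic].
  - exact: finite_measure_integrable_cst.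
  - move=> n z Sz; rewrite ger0_norm ?sqn_ge0// PE.
    apply: (@le_trans _ _ (expR (x n z))).
      rewrite -[X in expR X](divfK (n0 n)) expRM_natr.
      by apply: lerXn2r; rewrite ?nnegrE ?expR_ge0 ?expR_ge1Dx ?base0//.
    rewrite ler_expR; apply: lerD.
      by rewrite ler_pM2l// (le_trans (ler_norm _))// h1.
    apply: (@le_trans _ _ (sqn h.[z])); last exact: h2.
    by rewrite ler_pdivrMr// ler_peMr ?sqn_ge0// ler1n.
have le_lim : e <= \int[mu]_(z in S1) expR (2 * Re h.[z]).
  apply: (cvgr_to_ge lim); apply: nearW => n; apply: e_le_poly.
  by rewrite /P horner_exp hornerD hornerZ h0 mulr0 !hornerE expr1n.
have hE z : expR (2 * Re h.[z]) = expR (- Re p.[0]) * expR (Re p.[z]).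
  rewrite -expRD; congr expR; rewrite hornerZ !hornerE.
  by case: p.[z] => a b; case: p.[0] => c c' /=; field.
have [M hM] : exists M, forall z, S1 z -> `|Re p.[z]| <= M.
  by apply: trig_bounded; exists p.
have mp : measurable_fun S1 (fun z => Re p.[z]).
  by apply: measurable_Re; exact: measurable_horner.
have ip : mu.-integrable S1 (EFin \o (fun z => expR (Re p.[z]))).
  apply: (@bounded_integrable _ _ _ mu S1 mS1 _ (expR M)) => //.
    by apply: measurableT_comp => //.
  by move=> z Sz; rewrite ger0_norm ?expR_ge0// ler_expR (le_trans (ler_norm _))// hM.
move: le_lim; rewrite (@eq_Rintegral _ _ _ mu S1
  (fun z => expR (- Re p.[0]) * expR (Re p.[z])))//.
by rewrite RintegralZl// expRN mulrC ler_pdivlMr ?expR_gt0.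
Qed.

(** Dominated convergence, for [mu] on one side and for the arc length on the
    other, makes the inequality stable under bounded pointwise limits. *)
Lemma mean_bound_bounded (L : C -> R) : measurable_fun S1 L ->
  (exists M, forall z, S1 z -> `|L z| <= M) -> mean_bound L.
Proof.
move=> mL bL; have := bp_trig_measurable mL bL.
suff : forall f, bpclosure S1 trig f -> measurable_fun S1 f /\ mean_bound f.
  by move=> h /h[].
move=> f; elim=> {L mL bL f} [f tf|F M f bF ih FM Ff].
  split; last exact: mean_bound_trig.
  by case: tf => p ->; apply: measurable_Re; exact: measurable_horner.
have mF n : measurable_fun S1 (F n) := (ih n).1.
have mf : measurable_fun S1 f by exact: measurable_fun_cvg Ff.
split => //.
have lhs : e * expR (circle_mean (F n)) @[n --> \oo] --> e * expR (circle_mean f).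
  apply: cvgM; first exact: cvg_cst.
  apply: continuous_cvg; first exact: continuous_expR.
  apply: cvgM; first exact: cvg_cst.
  apply: (@dominated_cvg_Rintegral _ _ _ _ S1 mS1 _ _ (cst M)) => //.
  exact: finite_measure_integrable_cst.
have rhs : \int[mu]_(z in S1) expR (F n z) @[n --> \oo] --> \int[mu]_(z in S1) expR (f z).
  apply: (@dominated_cvg_Rintegral _ _ _ _ S1 mS1 _ _ (cst (expR M))) => //.
  + by move=> n; apply: measurableT_comp.
  + by move=> z Sz; apply: continuous_cvg; [exact: continuous_expR|exact: Ff].
  + exact: finite_measure_integrable_cst.
  + move=> n z Sz; rewrite ger0_norm ?expR_ge0// ler_expR.
    by rewrite (le_trans (ler_norm _))// FM.
by apply: (ler_cvg_to lhs rhs); apply: nearW => n; exact: (ih n).2.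
Qed.

End lower_bound.

(** * Divergence of the logarithmic integral *)
Section szego.
Context {R : realType}.
Local Notation C := R[i].
Local Notation S1 := (@unit_circle R).
Variables (mu mu_ac mu_s : {finite_measure set C -> \bar R}) (N : set C).
Hypothesis ac : mu_ac `<< arc_length.
Hypothesis mN : measurable N.
Hypothesis arcN : arc_length N = 0%E.
Hypothesis mu_sN : mu_s (~` N) = 0%E.
Hypothesis muE : forall A, measurable A -> mu A = (mu_ac A + mu_s A)%E.
Hypothesis log_int : (\int[lebesgue_measure]_(t in `[0%R, (2 * pi)%R])
  (lne (szego_weight mu_ac t) * ((2 * pi)^-1)%R%:E) = -oo)%E.

Let mS1 := @measurable_unit_circle R.
Let c : R := (2 * pi)^-1.
Let pi20 : 0 < 2 * pi :> R. Proof. by rewrite mulr_gt0// pi_gt0. Qed.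
Let c0 : 0 < c. Proof. by rewrite invr_gt0. Qed.

Let g := Radon_Nikodym_SigmaFinite.f mu_ac (@arc_length R).
Let g_ge0 z : (0 <= g z)%E. Proof. exact: Radon_Nikodym_SigmaFinite.f_ge0. Qed.
Let g_fin z : g z \is a fin_num. Proof. exact: Radon_Nikodym_SigmaFinite.f_fin_num. Qed.
Let g_int : arc_length.-integrable setT g.
Proof. exact: Radon_Nikodym_SigmaFinite.f_integrable. Qed.

Let a (z : C) : R := 2 * pi * fine (g z).

Let a_ge0 z : 0 <= a z.
Proof. by rewrite mulr_ge0 ?(ltW pi20)// fine_ge0. Qed.

Let measurable_a : measurable_fun setT a.
Proof.
apply: measurable_funM; first exact: measurable_cst.
apply: measurableT_comp => //; exact: measurable_int g_int.
Qed.

Let integrable_a : arc_length.-integrable S1 (EFin \o a).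
Proof.
apply: (integrableS measurableT) => //.
rewrite (_ : EFin \o a = (fun z => (2 * pi)%:E * g z)%E).
  exact: integrableZl.
by apply/funext => z; rewrite /= /a EFinM fineK.
Qed.

(* a is the weight w. L n truncates - log w at height n, and takes the value
   - n on the null set N that carries the singular part; negtrunc n is the
   truncation of the negative part of log w, whose integrals diverge. *)
Let ltrunc (n : nat) (z : C) : R :=
  if a z <= 0 then n%:R else Num.max (- n%:R) (Num.min n%:R (- ln (a z))).
Let L (n : nat) (z : C) : R := if z \in N then - n%:R else ltrunc n z.
Let negtrunc (n : nat) (z : C) : R :=
  if a z <= 0 then n%:R else Num.min n%:R (Num.max 0 (- ln (a z))).

Let measurable_lna : measurable_fun setT (fun z => - ln (a z)).
Proof. by apply: measurableT_comp => //; exact: measurableT_comp. Qed.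

Let measurable_if_a (f : C -> R) n : measurable_fun setT f ->
  measurable_fun setT (fun z => if a z <= 0 then n%:R else f z).
Proof.
move=> mf; apply: measurable_fun_if => //; first exact: measurable_fun_ler.
exact: measurable_funTS.
Qed.

Let measurable_L n : measurable_fun S1 (L n).
Proof.
apply: (measurable_funS measurableT) => //.
apply: measurable_fun_if => //.
- by apply: (measurable_fun_bool true); rewrite setTI (_ : _ @^-1` _ = N)//;
    apply/seteqP; split => z /=; [exact: set_mem|exact: mem_set].
- apply: measurable_funTS; apply: measurable_if_a.
  by apply: measurable_maxr => //; exact: measurable_minr.
Qed.

Let measurable_negtrunc n : measurable_fun S1 (negtrunc n).
Proof.
apply: (measurable_funS measurableT) => //; apply: measurable_if_a.
by apply: measurable_minr => //; exact: measurable_maxr.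
Qed.

Let L_bounded n z : `|L n z| <= n%:R.
Proof.
have n0 : 0 <= n%:R :> R by exact: ler0n.
rewrite /L /ltrunc; case: ifP => _; first by rewrite normrN ger0_norm.
case: ifP => _; first by rewrite ger0_norm.
rewrite ler_norml le_max lexx/= ge_max ge_min lexx/= andbT.
by rewrite (le_trans _ n0)// oppr_le0.
Qed.

Let negtrunc_ge0 n z : 0 <= negtrunc n z.
Proof. by rewrite /negtrunc; case: ifP => // _; rewrite le_min ler0n le_max lexx. Qed.

Let negtrunc_bounded n z : `|negtrunc n z| <= n%:R.
Proof.
rewrite ger0_norm ?negtrunc_ge0// /negtrunc; case: ifP => // _.
by rewrite ge_min lexx.
Qed.

(* Where w > 0, exp (L n) <= max (1, 1 / w). *)
Let expR_L_le n z : ~ N z -> expR (L n z) * a z <= a z + 1.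
Proof.
move=> Nz; rewrite /L memNset// /ltrunc; case: ifPn => [a0|].
  by rewrite (_ : a z = 0) ?mulr0 ?add0r//; apply/eqP; rewrite eq_le a0 a_ge0.
rewrite -ltNge => a0.
have n0 : 0 <= n%:R :> R by exact: ler0n.
have le1 : Num.max (- n%:R) (Num.min n%:R (- ln (a z))) <= Num.max 0 (- ln (a z)).
  rewrite ge_max le_max oppr_le0 n0/= ge_min; apply/orP; right.
  by rewrite le_max lexx orbT.
rewrite -ler_expR in le1.
have le2 : expR (Num.max 0 (- ln (a z))) <= 1 + (a z)^-1.
  have ai : 0 < (a z)^-1 by rewrite invr_gt0.
  case: (leP 0 (- ln (a z))) => _; last by rewrite expR0 lerDl ltW.
  by rewrite expRN lnK ?posrE// lerDr.
by have := le_trans le1 le2; rewrite -(ler_pM2r a0) mulrDl mul1r mulVf// gt_eqF.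
Qed.

(* The positive part of log w is at most w. *)
Let L_ge n z : ~ N z -> negtrunc n z - a z <= L n z.
Proof.
move=> Nz; rewrite /L memNset// /ltrunc /negtrunc.
case: ifPn => [_|]; first by rewrite gerBl.
rewrite -ltNge => a0.
have lna : ln (a z) <= a z by exact: ltW (ln_sublinear a0).
have n0 : 0 <= n%:R :> R by exact: ler0n.
have [l0|l0] := leP 0 (- ln (a z)).
  rewrite (max_r (x := - n%:R)); first by rewrite gerBl ltW.
  by rewrite le_min (le_trans _ l0) ?oppr_le0//; rewrite (le_trans _ n0)// oppr_le0.
rewrite min_r// sub0r le_max; apply/orP; right.
by rewrite le_min lerN2 lna andbT (le_trans _ n0)// oppr_le0 ltW.
Qed.

(* The absolutely continuous part contributes at most the mean of w + 1, and the
   singular part at most its mass since exp (- n) <= 1. *)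
Let exp_L_bound : exists B : R, forall n, \int[mu]_(z in S1) expR (L n z) <= B.
Proof.
pose B1 := (\int[arc_length]_(z in S1 `\` N) (g z + c%:E))%E.
pose B2 := (\int[mu_s]_(z in S1 `\` ~` N) 1%:E)%E.
have mS1N : measurable (S1 `\` N) by exact: measurableD.
have mS1N' : measurable (S1 `\` ~` N) by apply: measurableD => //; exact: measurableC.
have B1fin : B1 \is a fin_num.
  apply: integrable_fin_num => //; apply: integrableD => //.
    exact: (integrableS measurableT).
  exact: finite_measure_integrable_cst.
have B2fin : B2 \is a fin_num.
  by apply: integrable_fin_num => //; exact: finite_measure_integrable_cst.
exists (fine (B1 + B2)%E) => n.
have mh : measurable_fun S1 (fun z => (expR (L n z))%:E).
  by apply/measurable_EFinP; exact: measurableT_comp.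
have h0 z : S1 z -> (0 <= (expR (L n z))%:E)%E by rewrite lee_fin expR_ge0.
rewrite /Rintegral; apply: fine_le; [|by rewrite fin_numD B1fin B2fin|].
  apply: integrable_fin_num => //.
  apply: (@bounded_integrable _ _ _ mu S1 mS1 _ (expR n%:R)) => //.
  - by rewrite ltey_eq fin_num_measure.
  - exact: measurableT_comp.
  - move=> z _; rewrite ger0_norm ?expR_ge0// ler_expR.
    exact: le_trans (ler_norm _) (L_bounded _ _).
rewrite (eq_measure_integral (measure_add mu_ac mu_s)); last first.
  by move=> A mA _; apply: etrans (muE mA) _; exact/esym/measure_addE.
rewrite ge0_integral_measure_add//; apply: leeD.
  rewrite -(Radon_Nikodym_SigmaFinite.change_of_variables ac)//.
  have mhg : measurable_fun S1 (fun z => (expR (L n z))%:E * g z)%E.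
    apply: emeasurable_funM => //; apply: measurable_funTS.
    exact: measurable_int g_int.
  rewrite (ge0_negligible_integral mN)//; last first.
    by move=> z _; rewrite mule_ge0 ?lee_fin ?expR_ge0.
  apply: ge0_le_integral => //.
  - by move=> z _; rewrite mule_ge0 ?lee_fin ?expR_ge0.
  - by apply: measurable_funS mhg => // z [].
  - apply: emeasurable_funD => //; apply: measurable_funTS.
    exact: measurable_int g_int.
  - move=> z [_ Nz]; have := expR_L_le n Nz.
    rewrite -/(g z) -[g z]fineK// -EFinM -EFinD lee_fin /a /c.
    move=> h; rewrite -(@ler_pM2l _ (2 * pi)) ?pi20// (mulrDr (2 * pi)) (@mulfV _ (2 * pi)) ?gt_eqF//.
    by rewrite mulrCA.
rewrite (ge0_negligible_integral (measurableC mN))//.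
apply: ge0_le_integral => //.
- by apply: measurable_funS mh => // z [].
- by move=> z [_ /contrapT Nz]; rewrite lee_fin /L mem_set//.
Qed.

Let integrable_L n : arc_length.-integrable S1 (EFin \o L n).
Proof.
apply: (@bounded_integrable _ _ _ _ S1 mS1 _ n%:R) => //.
by rewrite ltey_eq fin_num_measure.
Qed.

Let integrable_negtrunc n : arc_length.-integrable S1 (EFin \o negtrunc n).
Proof.
apply: (@bounded_integrable _ _ _ _ S1 mS1 _ n%:R) => //.
by rewrite ltey_eq fin_num_measure.
Qed.

Let circle_mean_L n :
  circle_mean (negtrunc n) - circle_mean a <= circle_mean (L n).
Proof.
rewrite /circle_mean -mulrBr ler_pM2l// -RintegralB//.
have ib : arc_length.-integrable S1 (EFin \o (fun z => negtrunc n z - a z)).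
  exact: (integrableB mS1 (integrable_negtrunc n) integrable_a).
have mS1N : measurable (S1 `\` N) by exact: measurableD.
rewrite /Rintegral (negligible_integral mN mS1 ib arcN).
rewrite (negligible_integral mN mS1 (integrable_L n) arcN).
apply: le_Rintegral => //.
- by apply: integrableS ib => // z [].
- by apply: integrableS (integrable_L n) => // z [].
- by move=> z [_ Nz]; exact: L_ge.
Qed.

(* The integrand of the logarithmic integral for the density b. *)
Let F (b : C -> R) (z : C) : \bar R :=
  ((if (b z <= 0)%R then -oo else (ln (b z))%:E) * c%:E)%E.

Let measurable_F b : measurable_fun setT b -> measurable_fun S1 (F b).
Proof.
move=> mb; apply: (measurable_funS measurableT) => //.
apply: emeasurable_funM => //; apply: measurable_fun_if => //.
  exact: measurable_fun_ler.
apply: measurable_funTS; apply/measurable_EFinP.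
exact: measurableT_comp.
Qed.

(* The Radon-Nikodym derivative is replaced by its nonnegative version a. *)
Let integral_Fa : (\int[arc_length]_(z in S1) F a z = -oo)%E.
Proof.
pose b (z : C) : R := 2 * pi * fine (Radon_Nikodym (charge_of_finite_measure mu_ac) arc_length z).
have bint := Radon_Nikodym_integrable (nu := charge_of_finite_measure mu_ac) ac.
have mb : measurable_fun setT b.
  apply: measurable_funM; first exact: measurable_cst.
  apply: measurableT_comp => //; exact: measurable_int bint.
rewrite -log_int.
transitivity (\int[arc_length]_(z in S1) F b z)%E; last first.
  rewrite integral_arc; last exact: measurable_F.
  apply: eq_integral => t _; rewrite /F /szego_weight; congr (_ * _)%E.
  rewrite -[X in (_ * X)%E]fineK; last exact: Radon_Nikodym_fin_num.
  by rewrite -EFinM.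
apply: ae_eq_integral => //; [exact: measurable_F|exact: measurable_F|].
have := ae_eq_Radon_Nikodym_SigmaFinite ac mS1.
apply: filterS => z h Sz; rewrite /F /a /b.
by rewrite -/g in h; rewrite h.
Qed.

(* The positive part of the integrand can only raise the integral, so the
   value -oo forces its negative part to have an infinite integral. *)
Let cvg_negtrunc :
  (\int[arc_length]_(z in S1) (c * negtrunc n z)%:E)%E @[n --> \oo] --> +oo%E.
Proof.
have Fneg : (\int[arc_length]_(z in S1) (F a)^\- z = +oo)%E.
  have n0 : (0 <= \int[arc_length]_(z in S1) (F a)^\- z)%E by exact: integral_ge0.
  have p0 : (0 <= \int[arc_length]_(z in S1) (F a)^\+ z)%E by exact: integral_ge0.
  move: integral_Fa n0 p0; rewrite integralE.
  by case: (\int[_]_(_ in _) (F a)^\+ _)%E => [x| |]; case: (\int[_]_(_ in _) (F a)^\- _)%E.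
rewrite -Fneg; rewrite [X in _ --> X](_ : _ = \int[arc_length]_(z in S1)
    (fun z => limn (fun n => (c * negtrunc n z)%:E)) z)%E; last first.
  apply: eq_integral => z _; apply/esym/cvg_lim => //.
  rewrite /F /negtrunc funenegE; case: ifPn => [_|_].
    rewrite gt0_mulNye ?lte_fin//= maxye.
    apply/cvgeryP; apply/cvgryPge => A; near=> n.
    by rewrite -ler_pdivrMl//; near: n; exact: nbhs_infty_ger.
  apply: cvg_near_cst; near=> n.
  rewrite -EFinM -EFinN -EFin_max; congr EFin.
  rewrite min_r; last by near: n; exact: nbhs_infty_ger.
  by rewrite -mulNr mulrC -[X in _ = Num.max _ X](mul0r c) -maxr_pMl ?(ltW c0)// maxC.
apply: cvg_monotone_convergence => //.
- by move=> n; apply/measurable_EFinP; apply: measurable_funM.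
- by move=> n z _; rewrite lee_fin mulr_ge0 ?(ltW c0).
- move=> z _ m n mn; rewrite lee_fin ler_pM2l// /negtrunc.
  case: ifP => _; first by rewrite ler_nat.
  by rewrite le_min !ge_min lexx orbT andbT ler_nat mn.
Unshelve. all: by end_near. Qed.

(** If every polynomial were at squared distance at least [e > 0] from
    [conj z], then [e (1 + mean (L n)) <= e exp (mean (L n)) <= B] for all [n],
    whereas the means of the [L n] tend to [+oo]. *)
Lemma conj_approx_szego : poly_approx mu S1 (fun z => (z^*)%C).
Proof.
split => [|e e0]; first by apply: measurable_conj; exact: measurable_id.
apply: contrapT => /forallNP noapprox.
have e_le (q : {poly C}) : (e%:E <= sqint mu S1 (fun z => 1 - z * q.[z])%R)%E.
  rewrite (@eq_sqint _ mu S1 _ (fun z => (z^*)%C - q.[z])).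
    by rewrite leNgt; apply/negP; exact: noapprox.
  move=> z Sz; rewrite -[RHS]mul1r -(sqn_circle Sz) -sqnM mulrBr circle_conj//.
have [B LB] := exp_L_bound.
have bound n : circle_mean (negtrunc n) <= B / e + circle_mean a - 1.
  have Lb : exists M, forall z, S1 z -> `|L n z| <= M by exists n%:R => z _.
  have := mean_bound_bounded e_le (measurable_L n) Lb.
  rewrite /mean_bound => /le_trans /(_ (LB n)).
  rewrite mulrC -ler_pdivlMr// => /(le_trans (expR_ge1Dx _)).
  by have := circle_mean_L n; lra.
suff : (+oo <= (B / e + circle_mean a - 1)%:E)%E by rewrite leye_eq.
apply: (cvge_to_le cvg_negtrunc); apply: nearW => n.
rewrite -[X in (X <= _)%E]fineK ?lee_fin; last first.
  by apply: integrable_fin_num => //; exact: (integrableZl mS1 c (integrable_negtrunc n)).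
by rewrite -/(Rintegral _ _ _) RintegralZl//; exact: bound.
Qed.

End szego.

(** * The differential operator on polynomials *)
Section polynomial_operator.
Context {F : fieldType}.
Variables (r : nat) (d : 'I_r.+1 -> {poly F}).

Definition diff_op (p : {poly F}) : {poly F} := \sum_(k < r.+1) d k * p^`(k).

Lemma diff_opD p q : diff_op (p + q) = diff_op p + diff_op q.
Proof.
by rewrite /diff_op -big_split/=; apply: eq_bigr => k _; rewrite derivnD mulrDr.
Qed.

Lemma diff_opZ c p : diff_op (c *: p) = c *: diff_op p.
Proof.
rewrite /diff_op scaler_sumr; apply: eq_bigr => k _.
by rewrite derivnZ -scalerAr.
Qed.

Hypothesis deg_d : forall k : 'I_r.+1, (size (d k) <= k.+1)%N.
Hypothesis d_neq0 : forall n : nat, \sum_(j < r.+1) (n ^_ j)%:R * (d j)`_j != 0.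

Let diff_op_Xn n : (size (diff_op 'X^n) <= n.+1)%N /\
  (diff_op 'X^n)`_n = \sum_(j < r.+1) (n ^_ j)%:R * (d j)`_j.
Proof.
split.
  apply: (leq_trans (size_sum _ _ _)); apply/bigmax_leqP => k _.
  rewrite derivnXn mulrnAr.
  have [kn|kn] := leqP k n; last by rewrite ffact_small// mulr0n size_poly0.
  rewrite -scaler_nat (leq_trans (size_scale_leq _ _))//.
  rewrite (leq_trans (size_polyMleq _ _))// size_polyXn.
  rewrite (@leq_trans (k.+1 + (n - k).+1).-1)//; last by rewrite addnS/= addSn subnKC.
  by rewrite -!subn1 leq_sub2r// leq_add2r.
rewrite /diff_op coef_sum; apply: eq_bigr => k _.
rewrite derivnXn mulrnAr coefMn coefMXn.
have [kn|kn] := leqP k n; last by rewrite ffact_small// mulr0n mul0r.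
by rewrite ltnNge leq_subr/= subKn// mulr_natl.
Qed.

(** [D X^n] has degree at most [n], with the [n]-th sum of the hypothesis as its
    coefficient of degree [n]: [D] is triangular with a nonzero diagonal, and
    the equation is solved from the top degree down. *)
Lemma diff_op_surj q : exists p, diff_op p = q.
Proof.
have [n qn] : exists n, (size q <= n)%N by exists (size q).
elim: n q qn => [|n ih] q qn.
  exists 0; move: qn; rewrite leqn0 size_poly_eq0 => /eqP ->.
  by rewrite /diff_op big1// => k _; rewrite derivn_poly0 ?size_poly0// mulr0.
have [s c] := diff_op_Xn n; have l0 := d_neq0 n.
pose a := q`_n / (diff_op 'X^n)`_n.
have [p pE] : exists p, diff_op p = q - a *: diff_op 'X^n.
  apply: ih; apply/leq_sizeP => j; rewrite leq_eqVlt => /predU1P[<-|nj].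
    by rewrite coefB coefZ /a divfK ?subrr// c.
  by rewrite coefB coefZ !(leq_sizeP _ n.+1 _)// mulr0 subrr.
by exists (p + a *: 'X^n); rewrite diff_opD diff_opZ pE subrK.
Qed.
End polynomial_operator.

(** * Densities and the isometry with the scalar space *)
Lemma measurable_inv_ge0 d (T : measurableType d) (R : realType) (D : set T) (h : T -> R) :
  (forall x, 0 <= h x) -> measurable_fun D h -> measurable_fun D (fun x => (h x)^-1).
Proof.
move=> h0 mh; under eq_fun do rewrite -powR_inv1//.
exact: (measurableT_comp (measurable_powR (-1))).
Qed.

Section density.
Context d (T : measurableType d) (R : realType).
Variables (mu nu : {finite_measure set T -> \bar R}) (h : T -> R).
Hypothesis h_ge0 : forall x, 0 <= h x.
Hypothesis h_int : mu.-integrable setT (EFin \o h).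
Hypothesis nuE : forall A, measurable A -> nu A = (\int[mu]_(x in A) (h x)%:E)%E.

Let measurable_h : measurable_fun setT h.
Proof. by apply/measurable_EFinP; exact: measurable_int h_int. Qed.

Let nu_mu : nu `<< mu.
Proof.
apply/null_content_dominatesP => A mA muA; rewrite nuE//.
by apply: null_set_integral => //; apply: measurable_funTS; exact: measurable_int h_int.
Qed.

Lemma ge0_integral_density (f : T -> \bar R) E : measurable E ->
  (forall x, 0 <= f x)%E -> measurable_fun E f ->
  (\int[nu]_(x in E) f x = \int[mu]_(x in E) (f x * (h x)%:E))%E.
Proof.
move=> mE f0 mf.
have SFi := Radon_Nikodym_SigmaFinite.f_integrable nu_mu.
rewrite -(Radon_Nikodym_SigmaFinite.change_of_variables nu_mu)//.
apply: ae_eq_integral => //.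
- apply: emeasurable_funM => //; apply: measurable_funTS; exact: measurable_int SFi.
- by apply: emeasurable_funM => //; apply: measurable_funTS; exact: measurable_int h_int.
- apply: ae_eqe_mul2l; apply: (ae_eq_subset (@subsetT _ E)).
  apply: integral_ae_eq => //; first exact: measurable_int h_int.
  move=> A _ mA; rewrite -nuE//; apply/esym.
  exact: Radon_Nikodym_SigmaFinite.f_integral.
Qed.

Lemma integral_density (f : T -> R) E : measurable E -> nu.-integrable E (EFin \o f) ->
  (\int[nu]_(x in E) (f x)%:E = \int[mu]_(x in E) (f x * h x)%:E)%E.
Proof.
move=> mE fi; rewrite -(Radon_Nikodym_change_of_variables nu_mu mE fi).
have mf := measurable_int _ fi.
apply: ae_eq_integral => //.
- by apply: emeasurable_funM => //; exact: measurable_funTS.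
- under eq_fun do rewrite EFinM.
  by apply: emeasurable_funM => //; apply: measurable_funTS; exact: measurable_int h_int.
- rewrite [X in ae_eq _ _ _ X](_ : _ = ((EFin \o f) \* (EFin \o h))%E); last first.
    by apply/funext => x /=; rewrite EFinM.
  apply: ae_eqe_mul2l; apply: (ae_eq_subset (@subsetT _ E)).
  apply: integral_ae_eq => //.
  + exact: Radon_Nikodym_integrable.
  + exact: measurable_int h_int.
  + by move=> A _ mA; rewrite -nuE// -Radon_Nikodym_integral.
Qed.

(** Here [nu = h mu] and [s = u mu]; where [h] vanishes so does [u], hence
    [(u / h) h = u] everywhere and [s = (u / h) nu]. *)
Lemma Radon_Nikodym_ratio (s : {charge set T -> \bar R}) (u : T -> R) :
  measurable_fun setT u -> (forall x, `|u x| <= h x) ->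
  (forall A, measurable A -> s A = (\int[mu]_(x in A) (u x)%:E)%E) ->
  s `<< nu /\ ae_eq nu setT (Radon_Nikodym s nu) (fun x => ((h x)^-1 * u x)%:E).
Proof.
move=> mu_ uh sE.
have mq : measurable_fun setT (fun x => (h x)^-1 * u x).
  apply: measurable_funM => //; exact: measurable_inv_ge0.
have q1 x : `|(h x)^-1 * u x| <= 1.
  have := h_ge0 x; rewrite le_eqVlt => /predU1P[h0|h0].
    by rewrite -h0 invr0 mul0r normr0.
  by rewrite normrM gtr0_norm ?invr_gt0// ler_pdivrMl// mulr1.
have qi E : measurable E -> nu.-integrable E (EFin \o (fun x => (h x)^-1 * u x)).
  move=> mE; apply: (bounded_integrable mE _ _ (M := 1)) => //.
    by rewrite ltey_eq fin_num_measure.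
  exact: measurable_funTS.
have sq A : measurable A -> s A = (\int[nu]_(x in A) ((h x)^-1 * u x)%:E)%E.
  move=> mA; rewrite sE// integral_density//; last exact: qi.
  apply: eq_integral => x _; congr EFin.
  have := h_ge0 x; rewrite le_eqVlt => /predU1P[h0|h0].
    by have := uh x; rewrite -h0 normr_le0 => /eqP ->; rewrite !mulr0.
  by rewrite mulrAC mulVf ?mul1r// gt_eqF.
have s_nu : s `<< nu.
  apply/null_content_dominatesP => A mA nuA; rewrite sq//.
  by apply: null_set_integral => //; exact: measurable_int (qi _ mA).
split => //; apply: integral_ae_eq => //.
- exact: Radon_Nikodym_integrable.
- exact/measurable_EFinP.
by move=> A _ mA; rewrite -sq// -Radon_Nikodym_integral.
Qed.

End density.

Section isometry.
Context {R : realType}.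
Local Open Scope sesquilinear_scope.
Local Notation C := R[i].
Variables (K : set C) (mK : measurable K).
Variables (mu : {finite_measure set C -> \bar R}) (muK : mu (~` K) = 0%E).
Variables (momK : finite_moments K mu) (r : nat) (d : 'I_r.+1 -> {poly C}).
Let M := sobolev_measure mK muK momK d.

(* h = |G|^2 is the density of the trace measure with respect to mu. *)
Let h (z : C) : R := \sum_(k < r.+1) sqn (d k).[z].

Let h_ge0 z : 0 <= h z. Proof. by apply: sumr_ge0 => k _; exact: sqn_ge0. Qed.

Let sqn_le_h k z : sqn (d k).[z] <= h z.
Proof. by rewrite /h (bigD1 k)//= lerDl sumr_ge0// => j _; exact: sqn_ge0. Qed.

Let gramE z k l : poly_gram d z k l = (d k).[z] * ((d l).[z])^*%C.
Proof. by rewrite mxE big_ord1 !mxE. Qed.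

Let Re_gram_diag z k : Re (poly_gram d z k k) = sqn (d k).[z].
Proof. by rewrite gramE /sqn; case: (d k).[z] => a b /=; ring. Qed.

Let sqn_int k : mu.-integrable setT (fun z => (sqn (d k).[z])%:E).
Proof.
have [+ _] := poly_gram_integrable mK muK momK d k k.
by under eq_fun do rewrite Re_gram_diag.
Qed.

Let h_int : mu.-integrable setT (EFin \o h).
Proof.
rewrite (_ : EFin \o h = (fun z => \sum_(k < r.+1) (sqn (d k).[z])%:E)%E).
  exact: integrable_sum.
by apply/funext => z /=; rewrite -sumEFin.
Qed.

Let traceE A : measurable A -> trace_measure M A = (\int[mu]_(z in A) (h z)%:E)%E.
Proof.
move=> mA; rewrite /trace_measure asboolT//.
have si k : mu.-integrable A (fun z => (sqn (d k).[z])%:E).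
  exact: integrableS (sqn_int k).
under [RHS]eq_integral do rewrite -sumEFin.
rewrite integral_sum// -sumEFin; apply: eq_bigr => k _.
rewrite mxE /cintegral /= (@eq_Rintegral _ _ _ mu _ (fun z => sqn (d k).[z])).
  by rewrite /Rintegral fineK//; exact: integrable_fin_num.
by move=> z _; rewrite Re_gram_diag.
Qed.

Let ReIm_gram_le z k l :
  `|Re (poly_gram d z k l)| <= h z /\ `|Im (poly_gram d z k l)| <= h z.
Proof.
have := sqn_le_h k z; have := sqn_le_h l z; rewrite gramE /sqn.
case: (d k).[z] => a b; case: (d l).[z] => a' b' /= h1 h2.
have := sqr_ge0 (a - a'); have := sqr_ge0 (a + a').
have := sqr_ge0 (b - b'); have := sqr_ge0 (b + b').
have := sqr_ge0 (a - b'); have := sqr_ge0 (a + b').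
have := sqr_ge0 (b - a'); have := sqr_ge0 (b + a').
by move=> *; split; rewrite ler_norml; apply/andP; split; nra.
Qed.

Let measurable_gram k l : measurable_fun setT (fun z => poly_gram d z k l).
Proof.
under eq_fun do rewrite gramE.
apply: measurable_cM; first exact: measurable_horner.
by apply: measurable_conj; exact: measurable_horner.
Qed.

Let mmeasure_ReE k l A : measurable A ->
  mmeasure_Re M k l A = (\int[mu]_(z in A) (Re (poly_gram d z k l))%:E)%E.
Proof.
move=> mA; rewrite /mmeasure_Re mxE /= /Rintegral fineK//.
apply: integrable_fin_num => //.
exact: integrableS (poly_gram_integrable mK muK momK d k l).1.
Qed.

Let mmeasure_ImE k l A : measurable A ->
  mmeasure_Im M k l A = (\int[mu]_(z in A) (Im (poly_gram d z k l))%:E)%E.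
Proof.
move=> mA; rewrite /mmeasure_Im mxE /= /Rintegral fineK//.
apply: integrable_fin_num => //.
exact: integrableS (poly_gram_integrable mK muK momK d k l).2.
Qed.

Let RN_Re k l := Radon_Nikodym_ratio h_ge0 h_int traceE (s := mmeasure_Re M k l)
  (measurable_Re (measurable_gram k l)) (fun z => (ReIm_gram_le z k l).1) (@mmeasure_ReE k l).

Let RN_Im k l := Radon_Nikodym_ratio h_ge0 h_int traceE (s := mmeasure_Im M k l)
  (measurable_Im (measurable_gram k l)) (fun z => (ReIm_gram_le z k l).2) (@mmeasure_ImE k l).

Let measurable_trace_density k l : measurable_fun setT (fun z => trace_density M z k l).
Proof.
apply: measurable_ReIm; under eq_fun do rewrite mxE /=.
  apply: measurableT_comp => //; apply: measurable_int.
  exact: Radon_Nikodym_integrable (RN_Re k l).1.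
apply: measurableT_comp => //; apply: measurable_int.
exact: Radon_Nikodym_integrable (RN_Im k l).1.
Qed.

Lemma trace_density_gram :
  {ae trace_measure M, forall z, trace_density M z = ((h z)^-1)%:C%C *: poly_gram d z}.
Proof.
have : {ae trace_measure M, forall z, forall kl : 'I_r.+1 * 'I_r.+1,
    trace_density M z kl.1 kl.2 = ((h z)^-1)%:C%C * poly_gram d z kl.1 kl.2}.
  apply: filter_forall => -[k l] /=.
  apply: filterS2 (RN_Re k l).2 (RN_Im k l).2 => z /(_ I) zRe /(_ I) zIm.
  rewrite mxE zRe zIm /=; case: (poly_gram d z k l) => a b /=.
  by apply/eqP; rewrite eq_complex/= !mul0r subr0 addr0 !eqxx.
apply: filterS => z hz; apply/matrixP => k l; rewrite [RHS]mxE.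
exact: (hz (k, l)).
Qed.

Definition gdot (F : C -> 'rV[C]_r.+1) (z : C) : C := (F z *m poly_col d z) 0 0.

Let gdotE F z : gdot F z = \sum_k F z 0 k * (d k).[z].
Proof. by rewrite /gdot mxE; apply: eq_bigr => k _; rewrite mxE. Qed.

Lemma measurable_gdot (F : C -> 'rV[C]_r.+1) : (forall k, measurable_fun K (fun z => F z 0 k)) ->
  measurable_fun K (gdot F).
Proof.
move=> mF; rewrite (_ : gdot F = (fun z => \sum_k F z 0 k * (d k).[z])); last first.
  by apply/funext => z; exact: gdotE.
by apply: measurable_csum => k; apply: measurable_cM => //; exact: measurable_horner.
Qed.

Let form_gram (v : 'rV[C]_r.+1) z :
  (v *m poly_gram d z *m v ^t*) 0 0 = (v *m poly_col d z) 0 0 * ((v *m poly_col d z) 0 0)^*%C.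
Proof.
rewrite /poly_gram mulmxA -mulmxA.
rewrite (_ : poly_col d z ^t* *m v ^t* = (v *m poly_col d z) ^t*); last first.
  by rewrite trmx_mul map_mxM.
by rewrite mxE big_ord1 !mxE.
Qed.

(** [F M'_tau F^* dtau = (|F G|^2 / h) (h dmu)], and [F G] vanishes with [h]. *)
Lemma normL2M_gdot (F : C -> 'rV[C]_r.+1) : (forall k, measurable_fun K (fun z => F z 0 k)) ->
  normL2M K M F = normL2 K mu (gdot F).
Proof.
move=> mF; congr sqrte.
have mg := measurable_gdot mF.
have mq : measurable_fun K (fun z => ((h z)^-1 * sqn (gdot F z))%:E).
  apply/measurable_EFinP; apply: measurable_funM; last exact: measurable_sqn.
  apply: (measurable_funS measurableT) => //; apply: measurable_inv_ge0 => //.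
  by apply/measurable_EFinP; exact: measurable_int h_int.
transitivity (\int[trace_measure M]_(z in K) ((h z)^-1 * sqn (gdot F z))%:E)%E.
  apply: ae_eq_integral => //.
    apply/measurable_EFinP; apply: measurable_Re.
    rewrite (_ : (fun z => _) = (fun z => \sum_l (\sum_k F z 0 k *
        trace_density M z k l) * (F z 0 l)^*%C)); last first.
      apply/funext => z; rewrite mxE; apply: eq_bigr => l _.
      by rewrite !mxE.
    apply: measurable_csum => l; apply: measurable_cM; last exact: measurable_conj.
    apply: measurable_csum => k; apply: measurable_cM => //.
    exact: measurable_funTS.
  apply: filterS trace_density_gram => z zE _; congr EFin.
  rewrite zE -scalemxAr -scalemxAl mxE form_gram /gdot.
  by case: ((_ *m _) 0 0) => a b; rewrite /sqn/=; ring.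
rewrite (ge0_integral_density h_int traceE)//; last first.
  by move=> z; rewrite lee_fin mulr_ge0 ?invr_ge0 ?sqn_ge0.
apply: eq_integral => z _; rewrite -EFinM normc_sqr; congr EFin.
have := h_ge0 z; rewrite le_eqVlt => /predU1P[h0|h0]; last by field; rewrite gt_eqF.
rewrite -h0 mulr0 gdotE big1 ?/sqn/= ?expr0n ?addr0// => k _.
have : sqn (d k).[z] = 0 by apply/eqP; rewrite eq_le sqn_ge0 andbT h0 sqn_le_h.
rewrite /sqn => /eqP; rewrite paddr_eq0 ?sqr_ge0// !sqrf_eq0.
by case: (d k).[z] => a b /= /andP[/eqP -> /eqP ->]; rewrite mulr0.
Qed.

End isometry.

(** * Density of the polynomials in the Sobolev space *)
Section polynomial_derivatives.
Context {R : realType}.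
Local Notation C := R[i].

(** Off [z] the quotient is the polynomial [s] with
    [q - q(z) = s (X - z)], and [s(z) = q'(z)]. *)
Lemma cvg_difference_quotient (K : set C) (q : {poly C}) (z : C) :
  (q.[w] - q.[z]) / (w - z) @[w --> within K z^'] --> q^`().[z].
Proof.
have : root (q - (q.[z])%:P) z by rewrite rootE !hornerE subrr.
move=> /factor_theorem[s sE].
have qE w : q.[w] - q.[z] = s.[w] * (w - z).
  have /(congr1 (fun p => p.[w])) := sE.
  by rewrite !hornerE.
have -> : q^`().[z] = s.[z].
  have /(congr1 (fun p => p^`().[z])) := sE.
  rewrite derivB derivC subr0 derivM => ->.
  by rewrite !hornerE derivXsubC !hornerE subrr mulr0 add0r.
apply: (@cvg_trans _ (s.[w] @[w --> within K z^'])).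
  apply: near_eq_cvg; apply: cvg_within.
  near=> w.
  rewrite qE mulfK// subr_eq0.
  by near: w; exact: nbhs_dnbhs_neq.
apply: cvg_within_filter; apply: cvg_within_filter.
exact: horner_continuous.
Unshelve. all: by end_near. Qed.

Lemma derivative_row_poly_row (K : set C) (r : nat) (p : {poly C}) :
  derivative_row K (poly_row r p).
Proof.
move=> k l lk z Kz; rewrite [poly_row r p z 0 l]mxE lk derivnS.
under eq_fun do rewrite !mxE.
exact: cvg_difference_quotient.
Qed.

End polynomial_derivatives.

Section density_transfer.
Context {R : realType}.
Local Notation C := R[i].
Variables (K : set C) (mK : measurable K).
Variables (mu : {finite_measure set C -> \bar R}) (muK : mu (~` K) = 0%E).
Variables (momK : finite_moments K mu) (r : nat) (d : 'I_r.+1 -> {poly C}).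
Let M := sobolev_measure mK muK momK d.
Hypothesis deg_d : forall k : 'I_r.+1, (size (d k) <= k.+1)%N.
Hypothesis d_neq0 : forall n : nat, \sum_(j < r.+1) (n ^_ j)%:R * (d j)`_j != 0.

Lemma gdot_poly_row p : gdot d (poly_row r p) = (fun z => (diff_op d p).[z]).
Proof.
apply/funext => z; rewrite /gdot /diff_op mxE horner_sum.
by apply: eq_bigr => k _; rewrite !mxE hornerM mulrC.
Qed.

Let measurable_poly_row p k : measurable_fun K (fun z => poly_row r p z 0 k).
Proof. by under eq_fun do rewrite mxE; exact: measurable_horner. Qed.

(** If [q] is close to [F G] in [L^2_mu] and [D p = q], then the row of [p] is
    equally close to [F] in [L^2(M)], by the isometry. *)
Lemma dense_poly_rows :
  dense_for (normL2 K mu) polys (L2 K mu) ->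
  dense_for (normL2M K M) (@poly_rows R r) (W2 K M).
Proof.
move=> [polysL2 dense]; split.
  move=> _ [p ->].
  have L2Mp : L2M K M (poly_row r p).
    split=> [k|]; first exact: measurable_poly_row.
    rewrite normL2M_gdot; last exact: (measurable_poly_row p).
    rewrite gdot_poly_row.
    by have [] := polysL2 (fun z => (diff_op d p).[z]) (ex_intro _ (diff_op d p) erefl).
  have norm0 : normL2M K M (poly_row r p - poly_row r p) = 0%E.
    rewrite subrr normL2M_gdot; last first.
      by move=> k; under eq_fun do rewrite mxE; exact: measurable_cst.
    rewrite /normL2 (_ : integral _ _ _ = 0%E) ?sqrte0//.
    apply: integral0_eq => z _; rewrite /gdot mul0mx mxE normc0 expr0n.
    by [].
  split => // e e0; exists (poly_row r p); last by rewrite norm0 lte_fin.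
  by split => //; exists (poly_row r p); split => //; exact: derivative_row_poly_row.
move=> F [[mF Ffin] _] e e0.
have L2F : L2 K mu (gdot d F).
  by split; [exact: measurable_gdot|rewrite -(normL2M_gdot mK muK momK)].
have [_ [q ->] qe] := dense _ L2F _ e0.
have [p pE] := diff_op_surj deg_d d_neq0 q.
exists (poly_row r p); first by exists p.
rewrite normL2M_gdot; last first.
  move=> k; rewrite (_ : (fun z => _) = (fun z => F z 0 k - poly_row r p z 0 k)).
    apply: measurable_cD => //; apply: measurable_cN; exact: measurable_poly_row.
  by apply/funext => z; rewrite !mxE.
rewrite (_ : gdot d _ = gdot d F - (fun z => q.[z]))//.
rewrite -pE -gdot_poly_row; apply/funext => z.
by rewrite /gdot /= mulmxBl [LHS]mxE [X in _ + X]mxE.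
Qed.

End density_transfer.

Section circle_density.
Context {R : realType}.
Local Notation C := R[i].
Local Notation S1 := (@unit_circle R).

Lemma normL2_sqint (mu : {measure set C -> \bar R}) D f :
  normL2 D mu f = sqrte (sqint mu D f).
Proof. by congr sqrte; apply: eq_integral => z _; rewrite normc_sqr. Qed.

Lemma sqrte_lt (x : \bar R) (e : R) : (0 < e) -> (0 <= x)%E -> (x < (e ^+ 2)%:E)%E ->
  (sqrte x < e%:E)%E.
Proof.
case: x => // x e0; rewrite lee_fin !lte_fin /= => x0 xe.
by rewrite -(ltr_pXn2r (n := 2)) ?nnegrE ?sqrtr_ge0 ?(ltW e0)// sqr_sqrtr.
Qed.

Lemma dense_polys_circle (mu : {finite_measure set C -> \bar R}) :
  poly_approx mu S1 (fun z => (z^*)%C) ->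
  dense_for (normL2 S1 mu) polys (L2 S1 mu).
Proof.
move=> conj_approx; have mS1 := @measurable_unit_circle R.
split=> [_ [p ->]|f [mf ffin] e e0].
  split; first exact: measurable_horner.
  rewrite normL2_sqint.
  have [M pM] := poly_sqn_bounded p.
  have : mu.-integrable S1 (fun z => (sqn p.[z])%:E).
    apply: (bounded_integrable mS1 _ _ (M := M)) => //.
    - by rewrite ltey_eq fin_num_measure.
    - by apply: measurable_sqn; exact: measurable_horner.
    - by move=> z Sz; rewrite ger0_norm ?sqn_ge0 ?pM.
  move=> /(integrable_fin_num mS1); rewrite -/(sqint _ _ _).
  by case: (sqint _ _ _) => // x _; rewrite ltry.
have sfin : (sqint mu S1 f < +oo)%E.
  move: ffin; rewrite normL2_sqint.
  by case: (sqint mu S1 f) => // x _; rewrite ltry.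
have [_ /(_ (e ^+ 2))[|p pe]] := approx_L2 conj_approx mf sfin.
  by rewrite exprn_gt0.
exists (fun z => p.[z]); first by exists p.
rewrite normL2_sqint; apply: sqrte_lt => //; exact: sqint_ge0.
Qed.

End circle_density.

Unset Implicit Arguments.

Theorem corollary1 (R : realType)
  (K : set R[i]) (mK : measurable K)
  (mu : {finite_measure set R[i] -> \bar R}) (muK : mu (~` K) = 0%E)
  (momK : finite_moments K mu)
  (r : nat) (r_gt0 : (0 < r)%N) (d : 'I_r.+1 -> {poly R[i]})
  (deg_d : forall k : 'I_r.+1, (size (d k) <= k.+1)%N)
  (d_neq0 : forall n : nat,
     \sum_(j < r.+1) (n ^_ j)%:R * (d j)`_j != 0) :
  let M := sobolev_measure mK muK momK d in
  (dense_for (normL2 K mu) polys (L2 K mu) ->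
   dense_for (normL2M K M) (poly_rows r) (W2 K M)) /\
  (K = unit_circle -> infinite_set (msupport mu) ->
   forall mu_ac : {finite_measure set R[i] -> \bar R},
   ac_part arc_length mu mu_ac ->
   (\int[lebesgue_measure]_(t in `[0%R, (2 * pi)%R])
      (lne (szego_weight mu_ac t) * ((2 * pi)^-1)%R%:E) = -oo)%E ->
   dense_for (normL2M K M) (poly_rows r) (W2 K M)).
Proof.
move=> M; have transfer := dense_poly_rows mK muK momK deg_d d_neq0.
split=> [|KE _ mu_ac [ac [mu_s [[N [mN arcN mu_sN]] muE]]] log_int].
  exact: transfer.
apply: transfer; rewrite KE; apply: dense_polys_circle.
exact: (conj_approx_szego ac mN arcN mu_sN muE log_int).
Qed.
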